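(* Let $\delta\in(0,1)$. Let $\mathcal{X}_{(n)} = (\mathcal{X}_{(n)}, P_{(n)}, \pi_{(n)})$, $n \ge 1$, be a sequence of finite irreducible $\delta$-lazy Markov chains with non-negative Bakry--Émery curvature, i.e. $\mathrm{BE}(\mathcal{X}_{(n)}, P_{(n)}) \ge 0$ for every $n$. Assume that for every $\varepsilon \in (0,1/2)$, $$\lim_{n \to \infty} \frac{k_n^{2}\,(1+\log \Delta_n)\,t_{\mathrm{rel}}^{(n)}}{\sqrt{t_{\mathrm{mix}}^{(n)}(1-\varepsilon)}} = 0.$$ Then a cutoff occurs for the discrete mixing times of $(\mathcal{X}_{(n)})_n$, that is, for every $\varepsilon \in (0,1)$, $$\lim_{n\to\infty} \frac{t_{\mathrm{mix},d}^{(n)}(\varepsilon)}{t_{\mathrm{mix},d}^{(n)}(1-\varepsilon)} = 1.$$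
   Context: A finite irreducible Markov chain $(\mathcal{X},P)$ (also written $(\mathcal{X},P,\pi)$) consists of a finite set $\mathcal{X}$ with $|\mathcal{X}|\ge 2$ and an irreducible stochastic matrix $P$ on $\mathcal{X}$; $\pi$ is its stationary distribution. Neither reversibility nor symmetry of the support of $P$ is assumed. It is $\delta$-lazy if $P(x,x)\ge\delta$ for every $x\in\mathcal{X}$. Continuous-time semigroup: $\mathscr{P}_t(x,y) = e^{-t}\sum_{m\ge 0} \frac{t^m}{m!} P^m(x,y)$, $t\ge 0$. Total variation: $\|\mu_1-\mu_2\|_{\mathrm{TV}} = \frac12\sum_{x}|\mu_1(x)-\mu_2(x)|$. For $0<\varepsilon<1$: (continuous-time) mixing time $t_{\mathrm{mix}}(\varepsilon) = \inf\{t\ge 0 : \max_{x}\|\mathscr{P}_t(x,\cdot)-\pi\|_{\mathrm{TV}}\le\varepsilon\}$; discrete mixing time $t_{\mathrm{mix},d}(\varepsilon)=\inf\{m\in\mathbb{N}_0 : \max_x\|P^m(x,\cdot)-\pi\|_{\mathrm{TV}}\le\varepsilon\}$. For $f,g:\mathcal{X}\to\mathbb{R}$: $\Gamma(f,g)(x)=\frac12\sum_{y}(f(x)-f(y))(g(x)-g(y))P(x,y)$, $\Gamma(f)=\Gamma(f,f)$, $\mathcal{E}(f)=\sum_x \Gamma(f)(x)\pi(x)$, $\mathrm{Var}_\pi(f)=\sum_x (f(x)-\mathbb{E}_\pi[f])^2\pi(x)$ with $\mathbb{E}_\pi[f]=\sum_x f(x)\pi(x)$. Relaxation time: $t_{\mathrm{rel}}=\sup\{\mathrm{Var}_\pi(f)/\mathcal{E}(f)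 : f:\mathcal{X}\to\mathbb{R},\ \mathcal{E}(f)>0\}$. $\Delta(P)=\max\{1/P(x,y) : P(x,y)>0,\ x\ne y\}$. Directed distance: $d_P(x\to y)=\min\{k\in\mathbb{N}_0 : P^k(x,y)>0\}$ (with $P^0=I$). $k_{(\mathcal{X},P)}=\max\{d_P(y\to x) : d_P(x\to y)=1\}$. Laplacian: $\mathcal{L}f(x)=\sum_y P(x,y)(f(y)-f(x))$. The Bakry--Émery curvature $\mathrm{BE}(\mathcal{X},P)$ is the supremum of all $\kappa$ such that $\frac12\mathcal{L}\Gamma(f)(x)\ge\Gamma(f,\mathcal{L}f)(x)+\kappa\,\Gamma(f)(x)$ for every $f:\mathcal{X}\to\mathbb{R}$ and $x\in\mathcal{X}$. For the $n$-th chain, $t_{\mathrm{mix}}^{(n)}(\cdot)$, $t_{\mathrm{mix},d}^{(n)}(\cdot)$, $t_{\mathrm{rel}}^{(n)}$ are the mixing, discrete mixing and relaxation times of $(\mathcal{X}_{(n)},P_{(n)})$, $k_n=k_{(\mathcal{X}_{(n)},P_{(n)})}$, $\Delta_n=\Delta(P_{(n)})$. A quotient with positive numerator and zero denominator is read as $+\infty$ (so the assumed limit includes $t_{\mathrm{mix}}^{(n)}(1-\varepsilon)>0$ for all large $n$). *)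

(* Defs.v *)
From HB Require Import structures.
From mathcomp Require Import all_boot all_order all_algebra.
From mathcomp Require Import all_classical all_reals all_analysis.

Set Implicit Arguments.
Unset Strict Implicit.
Unset Printing Implicit Defensive.

Import Order.TTheory GRing.Theory Num.Theory.
Import numFieldNormedType.Exports.

Local Open Scope classical_set_scope.
Local Open Scope ring_scope.

Section Power.
Variables (R : realType) (X : finType).

(* Square matrices in mathcomp are indexed by ordinals; powers are defined
   directly here so that the state space may be any finType. *)
Fixpoint kpow (P : X -> X -> R) (m : nat) : X -> X -> R :=
  match m with
  | 0 => fun x y => (x == y)%:R
  | m'.+1 => fun x y => \sum_z P x z * kpow P m' z y
  end.

End Power.

Record markovChain (R : realType) := MarkovChain {
  state :> finType;
  trans : state -> state -> R;
  stat : state -> R;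
  card_state : (1 < #|state|)%N;
  trans_ge0 : forall x y, 0 <= trans x y;
  trans_sum1 : forall x, \sum_y trans x y = 1;
  trans_irr : forall x y, exists m, 0 < kpow trans m x y;
  stat_ge0 : forall x, 0 <= stat x;
  stat_sum1 : \sum_x stat x = 1;
  stat_inv : forall y, \sum_x stat x * trans x y = stat y
}.

Section Chain.
Variables (R : realType) (M : markovChain R).
Local Notation P := (@trans R M).
Local Notation pi := (@stat R M).
Implicit Types (f g : M -> R) (x y : M) (e : R).

Definition is_lazy (delta : R) : Prop := forall x, delta <= P x x.

Definition semigroup (t : R) x y : R :=
  expR (- t) * limn (series (fun m => t ^+ m / m`!%:R * kpow P m x y)).

Definition tv (mu1 mu2 : M -> R) : R := 2^-1 * \sum_x `|mu1 x - mu2 x|.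

(* The default value 0 of this maximum is harmless: tv is nonnegative. *)
Definition worst_tv (Q : M -> M -> R) : R := \big[Num.max/0]_x tv (Q x) pi.

Definition tmix e : R := inf [set t : R | 0 <= t /\ worst_tv (semigroup t) <= e].

Definition tmix_d e : R :=
  inf [set (m%:R : R) | m in [set m : nat | worst_tv (kpow P m) <= e]].

Definition Gamma f g x : R :=
  2^-1 * \sum_y (f x - f y) * (g x - g y) * P x y.

Definition energy f : R := \sum_x Gamma f f x * pi x.

Definition mean f : R := \sum_x f x * pi x.

Definition var f : R := \sum_x (f x - mean f) ^+ 2 * pi x.

Definition trel : R := sup [set var f / energy f | f in [set f | 0 < energy f]].

(* The index set is nonempty by irreducibility and 1 < #|M|, and all values
   are positive, so the default 0 never occurs. *)
Definition Delta : R :=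
  \big[Num.max/0]_(p : M * M | (0 < P p.1 p.2) && (p.1 != p.2)) (P p.1 p.2)^-1.

Definition dist x y : nat := ex_minn (trans_irr x y).

Definition return_dist : nat :=
  (\max_(p : M * M | dist p.1 p.2 == 1) dist p.2 p.1)%N.

Definition lapl f x : R := \sum_y P x y * (f y - f x).

Definition BE_curvature : \bar R :=
  ereal_sup [set kappa%:E | kappa in [set kappa : R |
    forall f x, Gamma f (lapl f) x + kappa * Gamma f f x <=
                2^-1 * lapl (Gamma f f) x]].

End Chain.

(* Main.v *)
Require Import Defs.
From HB Require Import structures.
From mathcomp Require Import all_boot all_order all_algebra.
From mathcomp Require Import all_classical all_reals all_analysis.
From mathcomp Require Import ring lra.

(* Let T be the continuous mixing time at level 1 - e and t a time just above
   it, mu = semigroup t x. Non-negative curvature gives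
   Gamma (P_t f) <= P_t (Gamma f), hence the local Poincare inequality
   Var_mu(f) <= 2 t sup Gamma(f). It is applied to the log-density
   h = ln (mu / pi): along an edge h varies by at most O(k^2 (1 + ln Delta)),
   because P_t(x, z) >= P_t(x, y) P(y, z) t / O(E[N | X_t = y]) for the number N
   of jumps, E[N | X_t = y] is at most O(t + ln (1 / P_t(x, y))), and the diameter
   is O(k t) since each P_t(x, .) overlaps pi, where dist x0 has standard
   deviation O(k sqrt trel). Thus h concentrates on the scale
   k^2 (1 + ln Delta) sqrt t, and since mu overlaps pi, its mean is not larger:
   mu <= exp(O(k^2 (1 + ln Delta) sqrt t)) pi outside a set of small mu-mass.

   The passage to discrete time uses laziness. With P = I / L + (1 - 1 / L) Q,
   P^m and P_t are mixtures of powers of Q with binomial and Poisson weights,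
   and for m = L floor(t / L) the former are at most a constant times the
   latter. So P^m(x, .) has the same density bound up to a constant, and
   O(trel k^2 (1 + ln Delta) sqrt t) further steps of the L^2 contraction
   exp(- delta / trel) suffice. For the lower bound, P_t is a Poisson average of
   the P^m. *)

Set Implicit Arguments.
Unset Strict Implicit.
Unset Printing Implicit Defensive.

Import Order.TTheory GRing.Theory Num.Theory.
Import numFieldNormedType.Exports.

Local Open Scope classical_set_scope.
Local Open Scope ring_scope.

(** * Powers of stochastic kernels *)

Section Kernels.
Variables (R : realType) (X : finType).
Implicit Types (P : X -> X -> R) (f g : X -> R).

Definition act P f x : R := \sum_y P x y * f y.

Lemma act_le P f g x : (forall y, 0 <= P x y) ->
  (forall y, f y <= g y) -> act P f x <= act P g x.
Proof. by move=> P0 fg; apply: ler_sum => y _; rewrite ler_wpM2l. Qed.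

Lemma act_sum1 P c x : \sum_y P x y = 1 -> act P (fun=> c) x = c.
Proof. by move=> P1; rewrite /act -mulr_suml P1 mul1r. Qed.

Lemma actD P f g x : act P (fun y => f y + g y) x = act P f x + act P g x.
Proof. by rewrite /act -big_split /=; apply: eq_bigr => y _; rewrite mulrDr. Qed.

Lemma sum_eqr (x : X) f : \sum_y (x == y)%:R * f y = f x.
Proof.
rewrite (bigD1 x) //= eqxx mul1r big1 ?addr0 // => y /negbTE.
by rewrite eq_sym => ->; rewrite mul0r.
Qed.

Lemma kpow1 P x y : kpow P 1 x y = P x y.
Proof.
rewrite /= (bigD1 y) //= eqxx mulr1 big1 ?addr0 // => z /negbTE ->.
by rewrite mulr0.
Qed.

Lemma kpowD P m n x y :
  kpow P (m + n) x y = \sum_z kpow P m x z * kpow P n z y.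
Proof.
elim: m x => [|m IH] x; first by rewrite add0n /= sum_eqr.
rewrite addSn /=; under eq_bigr => z _ do rewrite IH mulr_sumr.
rewrite exchange_big /=; apply: eq_bigr => w _.
by rewrite mulr_suml; apply: eq_bigr => z _; rewrite mulrA.
Qed.

Lemma kpowSr P m x y : kpow P m.+1 x y = \sum_z kpow P m x z * P z y.
Proof.
by rewrite -addn1 kpowD; apply: eq_bigr => z _; rewrite kpow1.
Qed.

Lemma act_kpowS P m f x : act (kpow P m.+1) f x = act P (act (kpow P m) f) x.
Proof.
rewrite /act /=; under eq_bigr => y _ do rewrite mulr_suml.
rewrite exchange_big /=; apply: eq_bigr => z _.
by rewrite mulr_sumr; apply: eq_bigr => y _; rewrite mulrA.
Qed.

Section Stochastic.
Variable P : X -> X -> R.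
Hypothesis P0 : forall x y, 0 <= P x y.

Lemma kpow_ge0 m x y : 0 <= kpow P m x y.
Proof.
elim: m x => [|m IH] x /=; first by rewrite ler0n.
by apply: sumr_ge0 => z _; apply: mulr_ge0.
Qed.

Lemma kpow_ge m n x y z : kpow P m x y * kpow P n y z <= kpow P (m + n) x z.
Proof.
rewrite kpowD (bigD1 y) //= lerDl.
by apply: sumr_ge0 => w _; apply: mulr_ge0; exact: kpow_ge0.
Qed.

Lemma kpow_gt0D m n x y z : 0 < kpow P m x y -> 0 < kpow P n y z ->
  0 < kpow P (m + n) x z.
Proof. by move=> a b; apply: lt_le_trans (kpow_ge m n x y z); apply: mulr_gt0. Qed.

Lemma kpowS_gt0 m x y : 0 < kpow P m.+1 x y ->
  exists z, 0 < P x z /\ 0 < kpow P m z y.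
Proof.
rewrite /= lt0r => /andP[+ _].
rewrite psumr_neq0; last by move=> z _; apply: mulr_ge0 => //; exact: kpow_ge0.
move=> /hasP[z _ /=]; rewrite lt0r => /andP[+ _].
rewrite mulf_eq0 negb_or => /andP[a b]; exists z.
by rewrite !lt0r a b P0 kpow_ge0.
Qed.

Hypothesis P1 : forall x, \sum_y P x y = 1.

Lemma kpow_sum1 m x : \sum_y kpow P m x y = 1.
Proof.
elim: m x => [|m IH] x /=.
  by rewrite -[RHS](sum_eqr x (fun=> 1)); apply: eq_bigr => y _; rewrite mulr1.
rewrite exchange_big /= -[RHS](P1 x); apply: eq_bigr => z _.
by rewrite -mulr_sumr IH mulr1.
Qed.

Lemma kpow_le1 m x y : kpow P m x y <= 1.
Proof.
rewrite -(kpow_sum1 m x) (bigD1 y) //= lerDl.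
by apply: sumr_ge0 => z _; exact: kpow_ge0.
Qed.

End Stochastic.
End Kernels.

(** * Poisson averages *)

Section Poisson.
Variable R : realType.
Implicit Types (t u v c C : R) (a b : nat -> R).

(* The expectation of [a N], for N Poisson of parameter t, exists and is v.
   Stated as a relation because [limn] is a junk value on divergent series. *)
Definition is_pois t a v :=
  series (fun m => t ^+ m / m`!%:R * a m) @ \oo --> expR t * v.

(** By conversion [semigroup t x y] is [pois t] of the sequence [kpow P m x y], so results on
    Poisson averages apply to it directly. *)
Definition pois t a : R := expR (- t) * limn (series (fun m => t ^+ m / m`!%:R * a m)).

Lemma seq_cvg_ext (f g : nat -> R) (l : R) :
  f =1 g -> f @ \oo --> l -> g @ \oo --> l.
Proof. by move=> /funext ->. Qed.

Lemma expRNM t : expR (- t) * expR t = 1 :> R.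
Proof. by rewrite -expRD addNr expR0. Qed.

Lemma is_pois_eq t a v : is_pois t a v -> pois t a = v.
Proof. by rewrite /is_pois /pois => /cvg_lim ->//; rewrite mulrA expRNM mul1r. Qed.

Lemma series_exp (t : R) : series (fun m => t ^+ m / m`!%:R : R) @ \oo --> expR t.
Proof. exact: is_cvg_series_exp_coeff. Qed.
Arguments series_exp : clear implicits.

Lemma is_pois_cst t c : is_pois t (fun=> c) c.
Proof.
apply: seq_cvg_ext (cvgM (series_exp t) (cvg_cst c)) => n.
by rewrite /series /GRing.mul /= mulr_suml.
Qed.
Arguments is_pois_cst : clear implicits.

Lemma is_poisD t a b u v : is_pois t a u -> is_pois t b v ->
  is_pois t (fun m => a m + b m) (u + v).
Proof.
move=> A B; rewrite /is_pois mulrDr.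
apply: seq_cvg_ext (cvgD A B) => n.
by rewrite /series /GRing.add /= -big_split /=; apply: eq_bigr => i _; rewrite mulrDr.
Qed.

Lemma is_poisZ t a c v : is_pois t a v -> is_pois t (fun m => c * a m) (c * v).
Proof.
move=> A; rewrite /is_pois mulrCA.
apply: seq_cvg_ext (cvgM (cvg_cst c) A) => n.
rewrite /series /GRing.mul /= mulr_sumr.
by apply: eq_bigr => i _; exact: mulrCA.
Qed.

Lemma is_pois_ext t a b v : a =1 b -> is_pois t a v -> is_pois t b v.
Proof. by move=> /funext ->. Qed.

Lemma is_pois_sum t (I : finType) (a : I -> nat -> R) (v : I -> R) :
  (forall i, is_pois t (a i) (v i)) ->
  is_pois t (fun m => \sum_i a i m) (\sum_i v i).
Proof.
move=> H.
suff : forall r : seq I, is_pois t (fun m => \sum_(i <- r) a i m) (\sum_(i <- r) v i).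
  by apply.
elim=> [|i r IH].
  by rewrite big_nil; apply: is_pois_ext (is_pois_cst t 0) => m; rewrite big_nil.
rewrite big_cons; apply: is_pois_ext (is_poisD (H i) IH) => m.
by rewrite big_cons.
Qed.

Lemma is_pois_le t a b u v : 0 <= t -> (forall m, a m <= b m) ->
  is_pois t a u -> is_pois t b v -> u <= v.
Proof.
move=> t0 ab A B; rewrite -(ler_pM2l (expR_gt0 t)).
apply: ler_cvg_to A B _; near=> n; apply: ler_sum => i _.
by rewrite ler_wpM2l // divr_ge0 // exprn_ge0.
Unshelve. all: by end_near. Qed.

Lemma is_pois_uniq t a u v : is_pois t a u -> is_pois t a v -> u = v.
Proof. by move=> /is_pois_eq <- /is_pois_eq. Qed.

Lemma is_pois_term t a v m : 0 <= t -> (forall i, 0 <= a i) ->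
  is_pois t a v -> t ^+ m / m`!%:R * a m <= expR t * v.
Proof.
move=> t0 a0 A; have F0 i : 0 <= t ^+ i / i`!%:R * a i.
  by rewrite mulr_ge0 // divr_ge0 // exprn_ge0.
rewrite -(cvg_lim _ A) //.
have := @nondecreasing_cvgn_le R _ (nondecreasing_series (P := xpredT) (m := 0)
  (fun i _ _ => F0 i)) (cvgP _ A) m.+1.
apply: le_trans; rewrite /series /= big_nat_recr //= lerDr.
by apply: sumr_ge0.
Qed.

(** The Poisson generating function: [u = expR 1] will give an exponential moment, [u = 1 - p] the
    start of the thinning induction. *)
Lemma is_pois_geo t u : is_pois t (fun m => u ^+ m) (expR (t * (u - 1))).
Proof.
rewrite /is_pois -expRD mulrBr mulr1 addrC subrK.
apply: seq_cvg_ext (series_exp (t * u)) => n.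
by apply: eq_bigr => i _; rewrite exprMn mulrAC.
Qed.

(** Size biasing, from m / m! = 1 / (m - 1)!. The truncated predecessor at [m = 0] is harmless
    because of the factor [m%:R]. *)
Lemma is_pois_shift t a v :
  is_pois t a v -> is_pois t (fun m => m%:R * a m.-1) (t * v).
Proof.
move=> A; rewrite /is_pois -cvg_shiftS mulrCA.
apply: seq_cvg_ext (cvgM (cvg_cst t) A) => n.
rewrite /series /= big_nat_recl //= mul0r mulr0 add0r.
rewrite [LHS](mulr_sumr); apply: eq_bigr => i _.
rewrite factS natrM exprS invfM -!mulrA; congr (_ * (_ * _)).
by rewrite mulrCA mulKf ?pnatr_eq0.
Qed.

Lemma pois_cvg t a C : (forall m, `|a m| <= C) ->
  cvgn (series (fun m => t ^+ m / m`!%:R * a m)).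
Proof.
move=> aC; apply: normed_cvg; have C0 : 0 <= C by apply: le_trans (aC 0%N).
apply: (@series_le_cvg _ _ (fun m => `|t| ^+ m / m`!%:R * C)) => [n|n|n|].
- exact: normr_ge0.
- by rewrite mulr_ge0 // divr_ge0 // exprn_ge0.
- rewrite /= (normrM (_ / _)) (normrM (_ ^+ _)) normrX normfV.
  by rewrite (@ger0_norm _ n`!%:R) ?ler0n // ler_wpM2l //.
- exact: cvgP (is_pois_cst `|t| C).
Qed.

Lemma is_poisP t a C : (forall m, `|a m| <= C) -> is_pois t a (pois t a).
Proof.
move=> /(pois_cvg (t := t)) A; rewrite /is_pois /pois mulrA (mulrC (expR t)) expRNM.
by rewrite mul1r.
Qed.

(** Product rule for exp(-t) and a power series; differentiating the latter shifts [a] by one. *)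
Lemma is_derive_pois t a C : (forall m, `|a m| <= C) ->
  is_derive t 1 (fun t => pois t a) (pois t (fun m => a m.+1 - a m)).
Proof.
move=> aC.
have cE b : (fun x => limn (series (fun m => x ^+ m / m`!%:R * b m))) =
    (fun x => limn (pseries (fun m => b m / m`!%:R) x)).
  apply/funext => x; congr (limn (series _)); apply: funext => m.
  by rewrite /= [LHS]mulrC mulrA mulrAC.
have dE b : pseries_diffs (fun m => b m / m`!%:R) =
    (fun m => b m.+1 / m`!%:R) :> (nat -> R).
  apply/funext => m; rewrite /pseries_diffs factS natrM invfM mulrCA mulVKf //.

have cv b x : (forall m, `|b m| <= C) -> cvgn (pseries (fun m => b m / m`!%:R) x).
  move=> /(pois_cvg (t := x)); rewrite /pseries.
  rewrite (_ : (fun m => _ / _ * b m) = (fun i => b i / i`!%:R * x ^+ i)) //.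
  by apply/funext => m; rewrite /= [LHS]mulrC mulrA mulrAC.
have D : is_derive t 1 (fun x => limn (series (fun m => x ^+ m / m`!%:R * a m)))
    (limn (series (fun m => t ^+ m / m`!%:R * a m.+1))).
  have := congr1 (@^~ t) (cE (fun m => a m.+1)) => /= ->; rewrite cE -dE.
  (* Termwise differentiation asks for convergence of the series and of its first two differentiated
     series at a point of modulus above |t|; with bounded [a] they converge everywhere. *)
  apply: (@pseries_snd_diffs _ _ (`|t| + 1)); rewrite ?dE; try exact: cv.
    by rewrite [ltRHS]ger0_norm // ltrDl.
rewrite /pois.
have D2 : is_derive t 1 (fun x : R => expR (- x)) (- expR (- t)).
  have : is_derive t 1 (expR \o -%R) (expR (- t) * (-1)).
    exact: is_derive1_comp.
  by move=> /is_derive_eq; apply; rewrite mulrN1.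
have B1 := @is_poisP t (fun m => a m.+1) C (fun m => aC m.+1).
have B0 := @is_poisP t a C aC.
have /is_pois_eq E : is_pois t (fun m => a m.+1 - a m)
    (pois t (fun m => a m.+1) + -1 * pois t a).
  refine (is_pois_ext _ (is_poisD B1 (is_poisZ (c := -1) B0))) => m.
  by rewrite mulN1r.
apply: is_derive_eq (is_deriveM D2 D) _; apply: etrans _ (esym E).
rewrite /pois /GRing.scale /= mulN1r mulrN; congr (_ - _); exact: mulrC.
Qed.

End Poisson.
Arguments series_exp {R} t.
Arguments is_pois_cst {R} t c.
Arguments is_poisZ {R t a} c {v}.
Arguments is_pois_term {R t a v} m.
Arguments is_pois_geo {R} t u.

(** * Distances and the semigroup *)

Section ChainBasics.
Variables (R : realType) (M : markovChain R).
Local Notation P := (@trans R M).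
Local Notation pi := (@stat R M).
Local Notation k := (return_dist M).
Implicit Types (f g : M -> R) (x y z : M).

Let P0 := @trans_ge0 R M.
Let P1 := @trans_sum1 R M.

Lemma trans_le1 x y : P x y <= 1.
Proof. by have := kpow_le1 P0 P1 1 x y; rewrite kpow1. Qed.

Lemma stat_kpow m y : \sum_x pi x * kpow P m x y = pi y.
Proof.
elim: m y => [|m IH] y.
  rewrite -[RHS](sum_eqr y); apply: eq_bigr => x _.
  by rewrite mulrC eq_sym.
under eq_bigr => x _ do rewrite mulr_sumr.
rewrite exchange_big /= -[RHS]IH; apply: eq_bigr => z _.
by rewrite -(@stat_inv R M z) mulr_suml; apply: eq_bigr => x _; rewrite mulrA.
Qed.

(** Some state has positive mass, and by invariance a path of positive probability carries mass from
    it to x. *)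
Lemma stat_gt0 x : 0 < pi x.
Proof.
have [y y0] : exists y, 0 < pi y.
  apply: contrapT => H.
  have := stat_sum1 M; rewrite big1 => [/eqP|y _]; first by rewrite eq_sym oner_eq0.
  apply/eqP; rewrite eq_le stat_ge0 andbT leNgt; apply/negP => y0.
  by apply: H; exists y.
have [m m0] := trans_irr y x.
rewrite -(stat_kpow m) (bigD1 y) //=; apply: ltr_pwDl; first exact: mulr_gt0.
by apply: sumr_ge0 => z _; rewrite mulr_ge0 ?stat_ge0 // kpow_ge0.
Qed.

Lemma dist_gt0 x y : 0 < kpow P (dist x y) x y.
Proof. by rewrite /dist; case: ex_minnP. Qed.

Lemma dist_min m x y : 0 < kpow P m x y -> (dist x y <= m)%N.
Proof. by rewrite /dist; case: ex_minnP => d _ + m0; apply. Qed.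

Lemma dist_triangle x y z : (dist x z <= dist x y + dist y z)%N.
Proof. apply: dist_min; apply: (kpow_gt0D P0 (dist_gt0 x y)); exact: dist_gt0. Qed.

Lemma distxx x : dist x x = 0%N.
Proof. by apply/eqP; rewrite -leqn0 dist_min //= eqxx. Qed.

Lemma dist_edge x y : 0 < P x y -> (dist x y <= 1)%N.
Proof. by move=> xy; apply: dist_min; rewrite kpow1. Qed.

Lemma dist_eq0 x y : dist x y = 0%N -> x = y.
Proof.
move=> d0; have := dist_gt0 x y; rewrite d0 /= ltr0n lt0b.
by move/eqP.
Qed.

Lemma dist_return x y : 0 < P x y -> (dist y x <= k)%N.
Proof.
move=> xy; have := dist_edge xy; rewrite leq_eqVlt => /orP[d1|].
  exact: (@leq_bigmax_cond _ (fun p : M * M => dist p.1 p.2 == 1)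
            (fun p => dist p.2 p.1) (x, y)).
by rewrite ltnS leqn0 => /eqP/dist_eq0 ->; rewrite distxx.
Qed.

Lemma ex_edge : exists x y, 0 < P x y /\ x != y.
Proof.
have /card_gt1P[x [y [_ _ xy]]] := card_state M.
have [m] := trans_irr x y; elim: m x xy => [|m IH] x xy.
  by rewrite /= (negbTE xy) ltxx.
move=> /(kpowS_gt0 P0)[z [xz zy]]; have [E|xz'] := eqVneq x z.
  by apply: IH zy; rewrite -E.
by exists x, z.
Qed.

Lemma return_dist_gt0 : (0 < k)%N.
Proof.
have [x [y [xy ne]]] := ex_edge; apply: leq_trans (dist_return xy).
by rewrite lt0n; apply/eqP => /dist_eq0 E; rewrite E eqxx in ne.
Qed.

Lemma Delta_ge1 : 1 <= Delta M.
Proof.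
have [x [y [xy ne]]] := ex_edge.
apply: le_trans (_ : (P x y)^-1 <= _); first by rewrite invf_ge1 // trans_le1.
apply: (@le_bigmax_cond _ _ _ 0 (x, y) _ (fun p : M * M => (P p.1 p.2)^-1)).
by rewrite /= xy.
Qed.

Lemma Delta_gt0 : 0 < Delta M.
Proof. exact: lt_le_trans Delta_ge1. Qed.

Lemma Delta_edge x y : 0 < P x y -> x != y -> (Delta M)^-1 <= P x y.
Proof.
move=> xy ne; rewrite invf_ple ?posrE ?Delta_gt0 //.
apply: (@le_bigmax_cond _ _ _ 0 (x, y) _ (fun p : M * M => (P p.1 p.2)^-1)).
by rewrite /= xy.
Qed.

(** Induction along a path; at its loops, which the edge hypothesis excludes, c <= 1 suffices. *)
Lemma edge_propagate (c : R) (phi : M -> R) m y z : 0 <= c <= 1 ->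
  (forall x, 0 <= phi x) ->
  (forall x w, 0 < P x w -> x != w -> c * phi x <= phi w) ->
  0 < kpow P m y z -> c ^+ m * phi y <= phi z.
Proof.
move=> /andP[c0 c1] phi0 H; elim: m y => [|m IH] y.
  rewrite /= ltr0n lt0b => /eqP ->; by rewrite expr0 mul1r.
move=> /(kpowS_gt0 P0)[w [yw wz]]; apply: le_trans (IH _ wz).
rewrite exprSr -mulrA ler_wpM2l ?exprn_ge0 //.
by have [<-|ne] := eqVneq y w; [rewrite ler_piMl | exact: H].
Qed.

(** A shortest path contains no loop, so each of its steps has probability at least 1 / Delta. *)
Lemma kpow_dist_ge x y : (Delta M) ^- dist x y <= kpow P (dist x y) x y.
Proof.
move E: (dist x y) => d; elim: d x E => [|d IH] x E.
  by rewrite (dist_eq0 E) /= eqxx expr0 invr1.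
have := dist_gt0 x y; rewrite E => /(kpowS_gt0 P0)[z [xz zy]].
have dz : dist z y = d.
  apply/eqP; rewrite eqn_leq dist_min //= -ltnS -E.
  by apply: leq_trans (dist_triangle x z y) _; rewrite -add1n leq_add2r dist_edge.
have ne : x != z by apply/eqP => xz'; rewrite -xz' E in dz; elim: (d) dz => // n + [].
apply: le_trans (_ : P x z * kpow P d z y <= _); last first.
  by have := kpow_ge P0 1 d x z y; rewrite kpow1 add1n.
rewrite exprS invfM ler_pM ?invr_ge0 ?exprn_ge0 ?(ltW Delta_gt0) //.
- exact: Delta_edge.
- exact: IH.
Qed.

Section Semigroup.
Variable t : R.

Lemma is_pois_sg x y : is_pois t (fun m => kpow P m x y) (semigroup t x y).
Proof.
apply: (@is_poisP _ t _ 1) => m; rewrite ger0_norm; first exact: kpow_le1.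
exact: kpow_ge0.
Qed.
Arguments is_pois_sg : clear implicits.

Lemma is_pois_act f x :
  is_pois t (fun m => act (kpow P m) f x) (act (semigroup t) f x).
Proof.
have := is_pois_sum (fun y => is_poisZ (f y) (is_pois_sg x y)).
have -> : act (semigroup t) f x = \sum_y f y * semigroup t x y.
  by apply: eq_bigr => y _; rewrite mulrC.
apply: is_pois_ext => m.
by apply: eq_bigr => y _; rewrite mulrC.
Qed.
Arguments is_pois_act : clear implicits.

Lemma semigroup_sum1 x : \sum_y semigroup t x y = 1.
Proof.
apply: is_pois_uniq (is_pois_sum (is_pois_sg x)) _.
by apply: is_pois_ext (is_pois_cst t 1) => m; rewrite kpow_sum1.
Qed.

Hypothesis t0 : 0 <= t.

Lemma semigroup_term m x y :
  t ^+ m / m`!%:R * kpow P m x y <= expR t * semigroup t x y.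
Proof.
apply: (is_pois_term m t0 _ (is_pois_sg x y)) => i; exact: kpow_ge0.
Qed.

Lemma semigroup_ge0 x y : 0 <= semigroup t x y.
Proof.
rewrite -(pmulr_rge0 _ (expR_gt0 t)); apply: le_trans (semigroup_term 0 x y).
by rewrite mulr_ge0 ?kpow_ge0 // expr0 fact0 divr1.
Qed.

End Semigroup.

Lemma semigroup_gt0 t x y : 0 < t -> 0 < semigroup t x y.
Proof.
move=> t0; have [m m0] := trans_irr x y.
rewrite -(pmulr_rgt0 _ (expR_gt0 t)); apply: lt_le_trans (semigroup_term (ltW t0) m x y).
by rewrite mulr_gt0 // divr_gt0 ?exprn_gt0 // ltr0n fact_gt0.
Qed.

(** As the total masses agree, the excess on A equals the deficit on its complement; both count in
    the l1 distance, which offsets the factor 1/2. *)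
Lemma tv_ge (mu1 mu2 : M -> R) (A : pred M) : \sum_x mu1 x = \sum_x mu2 x ->
  \sum_(x | A x) mu1 x - \sum_(x | A x) mu2 x <= tv mu1 mu2.
Proof.
move=> E; rewrite /tv ler_pdivlMl ?ltr0n // mulr_natl mulr2n.
have E2 : \sum_(x | A x) mu1 x - \sum_(x | A x) mu2 x =
          \sum_(x | ~~ A x) (mu2 x - mu1 x).
  by move: E; rewrite (bigID A) /= [RHS](bigID A) /= sumrB; lra.
rewrite [X in _ + X]E2 -sumrB [leRHS](bigID A) /=; apply: lerD; apply: ler_sum => x _.
  exact: ler_norm.
by rewrite distrC ler_norm.
Qed.

Lemma tv_ge0 (mu1 mu2 : M -> R) : 0 <= tv mu1 mu2.
Proof. by rewrite mulr_ge0 ?invr_ge0 ?ler0n // sumr_ge0. Qed.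

(** The sign of e enters through the default value 0 of the maximum. *)
Lemma worst_tv_leP (Q : M -> M -> R) e : 0 <= e ->
  (forall x, tv (Q x) pi <= e) <-> worst_tv Q <= e.
Proof.
move=> e0; split=> [H|H x]; first by apply: bigmax_le => // x _; exact: H.
by apply: le_trans H; exact: (@le_bigmax _ _ _ 0 (fun x => tv (Q x) pi) x).
Qed.

End ChainBasics.
Arguments is_pois_sg {R M} t x y.
Arguments is_pois_act {R M} t f x.

(** * Variance and relaxation time *)

Section FiniteWeights.
Variables (R : realType) (I : finType) (w : I -> R).
Implicit Types (f : I -> R) (c s : R).

(** Variance plus squared bias; besides minimality of the mean, it gives the variance lost in one
    averaging step in [var_dens_push]. *)
Lemma wvar_shift f c : \sum_i w i = 1 ->
  \sum_i (f i - c) ^+ 2 * w i =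
  \sum_i (f i - \sum_j f j * w j) ^+ 2 * w i + (\sum_j f j * w j - c) ^+ 2.
Proof.
move=> w1; set m := \sum_j f j * w j.
have D u : \sum_i (f i - u) ^+ 2 * w i =
    \sum_i f i ^+ 2 * w i - 2 * u * m + u ^+ 2.
  have -> : u ^+ 2 = \sum_i u ^+ 2 * w i by rewrite -mulr_sumr w1 mulr1.
  rewrite /m mulr_sumr -sumrB -big_split /=.
  by apply: eq_bigr => i _; ring.
by rewrite !D; ring.
Qed.

Lemma wvar_le f c : \sum_i w i = 1 ->
  \sum_i (f i - \sum_j f j * w j) ^+ 2 * w i <= \sum_i (f i - c) ^+ 2 * w i.
Proof. by move=> w1; rewrite (wvar_shift _ c w1) lerDl sqr_ge0. Qed.

Lemma wvarE f : \sum_i w i = 1 ->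
  \sum_i (f i - \sum_j f j * w j) ^+ 2 * w i =
  \sum_i f i ^+ 2 * w i - (\sum_j f j * w j) ^+ 2.
Proof.
move=> w1; have := wvar_shift f 0 w1; rewrite subr0.
by under eq_bigr do rewrite subr0; move=> ->; rewrite addrK.
Qed.

Hypothesis w0 : forall i, 0 <= w i.

Lemma wmarkov f s : s * \sum_(i | s <= `|f i|) w i <= \sum_i `|f i| * w i.
Proof.
rewrite [leRHS](bigID (fun i => s <= `|f i|)) /= mulr_sumr -[leLHS]addr0.
apply: lerD; last by apply: sumr_ge0 => i _; rewrite mulr_ge0.
by apply: ler_sum => i si; rewrite ler_wpM2r.
Qed.

Lemma wchebyshev f c s : 0 <= s ->
  s ^+ 2 * \sum_(i | s <= `|f i - c|) w i <= \sum_i (f i - c) ^+ 2 * w i.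
Proof.
move=> s0; rewrite [leRHS](bigID (fun i => s <= `|f i - c|)) /= mulr_sumr -[leLHS]addr0.
apply: lerD; last by apply: sumr_ge0 => i _; rewrite mulr_ge0 ?sqr_ge0.
apply: ler_sum => i si; rewrite ler_wpM2r // -[leRHS]real_normK ?num_real //.
by rewrite lerXn2r ?nnegrE.
Qed.

End FiniteWeights.

(** * Dirichlet form and Poincare inequality *)

Section Spectral.
Variables (R : realType) (M : markovChain R).
Local Notation P := (@trans R M).
Local Notation pi := (@stat R M).
Implicit Types (f g : M -> R) (x y z : M).

Let P0 := @trans_ge0 R M.
Let P1 := @trans_sum1 R M.
Let pi0 := @stat_ge0 R M.

Lemma Gamma_ge0 f x : 0 <= Gamma f f x.
Proof.
rewrite mulr_ge0 ?invr_ge0 ?ler0n // sumr_ge0 // => y _.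
by rewrite mulr_ge0 // -expr2 sqr_ge0.
Qed.

Lemma energy_ge0 f : 0 <= energy f.
Proof. by apply: sumr_ge0 => x _; rewrite mulr_ge0 ?Gamma_ge0. Qed.

Lemma energy_edge f x y :
  2^-1 * (pi x * P x y * (f x - f y) ^+ 2) <= energy f.
Proof.
rewrite /energy (bigD1 x) //= -[leLHS]addr0; apply: lerD; last first.
  by apply: sumr_ge0 => z _; rewrite mulr_ge0 ?Gamma_ge0.
rewrite /Gamma -[leRHS]mulrA ler_wpM2l ?invr_ge0 ?ler0n // (bigD1 y) //= mulrDl.
rewrite -[leLHS]addr0; apply: lerD; first by rewrite le_eqVlt; apply/orP; left; apply/eqP; ring.
apply: mulr_ge0 => //; apply: sumr_ge0 => z _.
by rewrite mulr_ge0 // -expr2 sqr_ge0.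
Qed.

(** Induction along a path with (a + b)^2 <= 2 a^2 + 2 b^2, each edge being controlled by its own
    term of the energy. *)
Lemma diff_le_energy x y : exists C : R, forall f, (f x - f y) ^+ 2 <= C * energy f.
Proof.
have [m] := trans_irr x y; elim: m x => [|m IH] x.
  rewrite /= ltr0n lt0b => /eqP ->; exists 0 => f.
  by rewrite subrr expr0n mul0r.
move=> /(kpowS_gt0 P0)[z [xz /IH[C HC]]].
exists (4 / (pi x * P x z) + 2 * C) => f.
have q0 : 0 < pi x * P x z by rewrite mulr_gt0 // stat_gt0.
have H1 : (f x - f z) ^+ 2 <= 2 / (pi x * P x z) * energy f.
  rewrite mulrAC ler_pdivlMr //; have := energy_edge f x z; lra.
have H2 := HC f.
have H3 : (f x - f y) ^+ 2 <= 2 * (f x - f z) ^+ 2 + 2 * (f z - f y) ^+ 2.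
  have := sqr_ge0 ((f x - f z) - (f z - f y)); nra.
apply: le_trans H3 _.
have -> : (4 / (pi x * P x z) + 2 * C) * energy f =
  2 * (2 / (pi x * P x z) * energy f) + 2 * (C * energy f) by ring.
lra.
Qed.

(** Only finiteness matters: it bounds the set in [trel], whose [sup] is then a genuine supremum. *)
Lemma poincare_bound : exists C : R, forall f, var f <= C * energy f.
Proof.
have [x0 [_ _]] := ex_edge M.
have /choice[C HC] := diff_le_energy x0.
exists (\sum_x C x * pi x) => f.
apply: le_trans (wvar_le f (f x0) (@stat_sum1 R M)) _.
rewrite mulr_suml; apply: ler_sum => x _.
rewrite [leRHS]mulrAC ler_wpM2r // -sqrrN opprB; exact: HC.
Qed.

(** By stationarity both endpoints of a random edge have law pi, and (a - b)^2 <= 2 a^2 + 2 b^2.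
    This yields [trel_ge]. *)
Lemma energy_le_var f : energy f <= 2 * var f.
Proof.
have -> : 2 * var f = \sum_x (\sum_y (f x - mean f) ^+ 2 * (pi x * P x y)) +
     \sum_x (\sum_y (f y - mean f) ^+ 2 * (pi x * P x y)).
  rewrite mulr_natl mulr2n; congr (_ + _).
    apply: eq_bigr => x _; rewrite -mulr_sumr -mulr_sumr P1 mulr1 //.
  rewrite exchange_big /=; apply: eq_bigr => y _.
  by rewrite -mulr_sumr stat_inv.
rewrite -big_split /=; apply: ler_sum => x _.
rewrite /Gamma -big_split /= [leLHS]mulrAC mulr_sumr.
apply: ler_sum => y _; rewrite -mulrDl.
have q0 : 0 <= pi x * P x y by rewrite mulr_ge0.
have := sqr_ge0 (f x - mean f + (f y - mean f)); nra.
Qed.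

Lemma ex_energy_gt0 : exists f, 0 < energy f.
Proof.
have [x [y [xy ne]]] := ex_edge M; exists (fun z => (z == x)%:R).
apply: lt_le_trans (energy_edge _ x y).
rewrite eqxx eq_sym (negbTE ne) subr0 expr1n mulr1.
by rewrite mulr_gt0 ?invr_gt0 ?ltr0n // mulr_gt0 // stat_gt0.
Qed.

Lemma has_sup_trel : has_sup [set var f / energy f | f in [set f : M -> R | 0 < energy f]].
Proof.
split; first by have [f f0] := ex_energy_gt0; exists (var f / energy f), f.
have [C HC] := poincare_bound; exists C => _ [f /= f0 <-].
by rewrite ler_pdivrMr.
Qed.

Lemma poincare f : var f <= trel M * energy f.
Proof.
(* A function of zero energy is outside the set defining [trel]; the crude bound shows that its
   variance vanishes. *)
have := energy_ge0 f; rewrite le_eqVlt => /orP[/eqP E|f0].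
  by have [C HC] := poincare_bound; rewrite -E mulr0; have := HC f; rewrite -E mulr0.
rewrite -ler_pdivrMr //; apply: sup_upper_bound; first exact: has_sup_trel.
by exists f.
Qed.

Lemma trel_ge : 2^-1 <= trel M.
Proof.
have [f f0] := ex_energy_gt0.
apply: le_trans (_ : var f / energy f <= _); last first.
  by rewrite ler_pdivrMr //; exact: poincare.
by rewrite ler_pdivlMr //; have := energy_le_var f; lra.
Qed.

End Spectral.

(** * Curvature and the local Poincare inequality *)

Section Calculus.
Variable R : realType.

Lemma is_derive_bigsum (I : finType) (h : I -> R -> R) (dh : I -> R) (s : R) :
  (forall i, is_derive s 1 (h i) (dh i)) ->
  is_derive s 1 (fun s => \sum_i h i s) (\sum_i dh i).
Proof.
move=> H; have -> : (fun s => \sum_i h i s) = \sum_i h i.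
  by apply/funext => u; rewrite fct_sumE.
elim/big_ind2 : _ => [|f df g dg Hf Hg|i _]; [exact: is_derive_cst| |exact: H].
exact: is_deriveD.
Qed.

Lemma derive_le (F F' : R -> R) (a b c : R) : a <= b ->
  (forall s : R, is_derive s 1 F (F' s)) -> (forall s, a <= s <= b -> F' s <= c) ->
  F b - F a <= c * (b - a).
Proof.
move=> ab dF F'c.
have [|s + ->] := @MVT_segment R F F' a b ab (fun s _ => dF s).
- apply/continuous_subspaceT => s; apply/differentiable_continuous.
  by apply/derivable1_diffP; have [] := dF s.
- by rewrite in_itv /= => /F'c H; rewrite ler_wpM2r // subr_ge0.
Qed.

Lemma is_pois0 (a : nat -> R) : is_pois 0 a (a 0%N).
Proof.
rewrite /is_pois -cvg_shiftS expR0 mul1r.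
apply: seq_cvg_ext (cvg_cst (a 0%N)) => n.
rewrite /series /= big_nat_recl //= expr0 fact0 divr1 mul1r big1 ?addr0 // => i _.
by rewrite exprS !mul0r.
Qed.

End Calculus.
Arguments is_pois0 {R} a.

(** * Derivatives along the semigroup *)

Section Curvature.
Variables (R : realType) (M : markovChain R).
Local Notation P := (@trans R M).
Implicit Types (f g : M -> R) (x y z : M) (s t : R).

Let P0 := @trans_ge0 R M.
Let P1 := @trans_sum1 R M.

Lemma laplE f x : lapl f x = act P f x - f x.
Proof.
rewrite /lapl; under eq_bigr do rewrite mulrBr.
by rewrite sumrB -mulr_suml P1 mul1r.
Qed.

Lemma lapl_sqr f x : lapl (fun y => f y ^+ 2) x - 2 * (f x * lapl f x) = 2 * Gamma f f x.
Proof.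
rewrite /lapl /Gamma [RHS]mulrA divff ?pnatr_eq0 // mul1r !mulr_sumr -sumrB.
by apply: eq_bigr => y _; ring.
Qed.

(** The supremum only provides an admissible K above each negative number. For given f and x that
    number is taken so close to 0 that the loss is at most e; the [+ 1] covers a vanishing Gamma. *)
Lemma BE_curvature_ge0 : (0 <= BE_curvature M)%E ->
  forall f x, Gamma f (lapl f) x <= 2^-1 * lapl (Gamma f f) x.
Proof.
move=> H f x; apply/ler_addgt0Pr => e e0.
have G1 : 0 < Gamma f f x + 1 by rewrite ltr_wpDl // Gamma_ge0.
pose k := - (e / (Gamma f f x + 1)).
have : (k%:E < BE_curvature M)%E.
  by apply: lt_le_trans H; rewrite lte_fin oppr_lt0 divr_gt0.
move=> /ereal_sup_gt[_ [K KH <-]]; rewrite lte_fin => kK.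
have := KH f x; have := Gamma_ge0 f x => g0 A.
have : k * Gamma f f x <= K * Gamma f f x by rewrite ler_wpM2r // ltW.
have : - e <= k * Gamma f f x.
  rewrite mulNr lerN2 mulrAC ler_pdivrMr //; nra.
lra.
Qed.

(** With [semigroup_forward], two evaluations of the same Poisson average, splitting off the first
    or the last jump; by uniqueness the semigroup commutes with P. *)
Lemma semigroup_backward t x y :
  is_pois t (fun m => kpow P m.+1 x y) (\sum_z P x z * semigroup t z y).
Proof. by apply: is_pois_sum => z; apply: is_poisZ; exact: is_pois_sg. Qed.
Arguments semigroup_backward : clear implicits.

Lemma semigroup_forward t x y :
  is_pois t (fun m => kpow P m.+1 x y) (\sum_z semigroup t x z * P z y).
Proof.
have := is_pois_sum (fun z => is_poisZ (P z y) (is_pois_sg t x z)).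
have -> : \sum_z semigroup t x z * P z y = \sum_z P z y * semigroup t x z.
  by apply: eq_bigr => z _; rewrite mulrC.
apply: is_pois_ext => m; rewrite kpowSr; apply: eq_bigr => z _.
by rewrite mulrC.
Qed.
Arguments semigroup_forward : clear implicits.

Lemma semigroup_comm t x y :
  \sum_z P x z * semigroup t z y = \sum_z semigroup t x z * P z y.
Proof. exact: is_pois_uniq (semigroup_backward t x y) (semigroup_forward t x y). Qed.

Lemma is_derive_semigroup t x y :
  is_derive t 1 (fun t => semigroup t x y)
    (\sum_z semigroup t x z * P z y - semigroup t x y).
Proof.
have b m : `|kpow P m x y| <= 1.
  by rewrite ger0_norm ?kpow_le1 // kpow_ge0.
apply: is_derive_eq (is_derive_pois t b) _; apply: is_pois_eq.
rewrite -mulN1r; have := is_poisD (semigroup_forward t x y) (is_poisZ (-1) (is_pois_sg t x y)).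
by apply: is_pois_ext => m; rewrite mulN1r.
Qed.

Lemma act_semigroup0 f x : act (semigroup 0) f x = f x.
Proof.
have := is_pois_act 0 f x => /is_pois_uniq; apply.
have -> : f x = act (kpow P 0) f x by rewrite /act /= sum_eqr.
exact: is_pois0.
Qed.

Lemma act_lapl t f x : act (semigroup t) (lapl f) x = lapl (act (semigroup t) f) x.
Proof.
rewrite laplE /act; under eq_bigr do rewrite laplE mulrBr.
rewrite sumrB; congr (_ - _).
under eq_bigr do rewrite /act mulr_sumr.
under [RHS]eq_bigr do rewrite mulr_sumr.
rewrite exchange_big /= [RHS]exchange_big /=; apply: eq_bigr => y _.
under eq_bigr do rewrite mulrA; under [RHS]eq_bigr do rewrite mulrA.
by rewrite -!mulr_suml semigroup_comm.
Qed.

(** The rule d/ds P_s h_s = P_s (L h_s + h'_s), used for both interpolations below. *)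
Lemma is_derive_interp (h h' : R -> M -> R) s x :
  (forall y, is_derive s 1 (h^~ y) (h' s y)) ->
  is_derive s 1 (fun s => act (semigroup s) (h s) x)
    (act (semigroup s) (fun y => lapl (h s) y + h' s y) x).
Proof.
move=> H; rewrite /act.
have D y : is_derive s 1 (fun s => semigroup s x y * h s y)
   (semigroup s x y * h' s y + h s y * (\sum_z semigroup s x z * P z y - semigroup s x y)).
  exact: is_deriveM (is_derive_semigroup s x y) (H y).
apply: is_derive_eq (is_derive_bigsum D) _.
rewrite big_split /=; under [RHS]eq_bigr do rewrite mulrDr.
rewrite [RHS]big_split /= addrC; congr (_ + _).
under [RHS]eq_bigr do rewrite laplE mulrBr.
under eq_bigr do rewrite mulrBr.
rewrite !sumrB; congr (_ - _); last by apply: eq_bigr => y _; rewrite mulrC.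
under [RHS]eq_bigr do rewrite /act mulr_sumr.
rewrite [RHS]exchange_big /=; apply: eq_bigr => y _.
by rewrite mulr_sumr; apply: eq_bigr => z _; ring.
Qed.

Lemma is_derive_act f x t :
  is_derive t 1 (fun t => act (semigroup t) f x) (lapl (act (semigroup t) f) x).
Proof.
rewrite -act_lapl.
have := @is_derive_interp (fun=> f) (fun _ _ => 0) t x.
under [X in is_derive _ _ _ X]eq_bigr do rewrite addr0.
by apply => y; exact: is_derive_cst.
Qed.

Lemma is_derive_act_rev f x t s :
  is_derive s 1 (fun s => act (semigroup (t - s)) f x) (- lapl (act (semigroup (t - s)) f) x).
Proof.
have D : is_derive s 1 (fun s : R => t - s) (-1).
  have := is_deriveD (is_derive_cst t s 1) (is_deriveNid s 1).
  by move=> /is_derive_eq; apply; rewrite add0r.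
have := is_derive1_comp (f := fun u => act (semigroup u) f x)
  (g := fun s => t - s) (is_derive_act f x (t - s)) D.
by move=> /is_derive_eq; apply; rewrite mulrN1.
Qed.

Section NonNeg.
Hypothesis K : forall f x, Gamma f (lapl f) x <= 2^-1 * lapl (Gamma f f) x.

(** With u = P_{t-s} f, the interpolation P_s Gamma(u) has derivative P_s (L Gamma(u) - 2 Gamma(u, L
    u)), non-negative by [K]. *)
Lemma Gamma_semigroup t f x : 0 <= t ->
  Gamma (act (semigroup t) f) (act (semigroup t) f) x <=
  act (semigroup t) (Gamma f f) x.
Proof.
move=> t0.
pose u s := act (semigroup (t - s)) f.
have D s y : is_derive s 1 (fun s => Gamma (u s) (u s) y) (- 2 * Gamma (u s) (lapl (u s)) y).
  have Dz z : is_derive s 1 (fun s => (u s y - u s z) ^+ 2 * P y z)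
      (- 2 * ((u s y - u s z) * (lapl (u s) y - lapl (u s) z) * P y z)).
    have E : is_derive s 1 (fun s => u s y - u s z) _ :=
      is_deriveB (is_derive_act_rev f y t s) (is_derive_act_rev f z t s).
    have := is_deriveM (is_deriveX 2 E) (is_derive_cst (P y z) s 1).
    move=> /is_derive_eq; apply.
    by rewrite /GRing.scale /= /u mulr0 add0r expr1; ring.
  have := is_deriveM (is_derive_cst (2^-1 : R) s 1) (is_derive_bigsum Dz).
  move=> /is_derive_eq H.
  have <- : (fun s => 2^-1 * (\sum_z (u s y - u s z) ^+ 2 * P y z)) =
            (fun s => Gamma (u s) (u s) y).
    by apply/funext => r; rewrite /Gamma; congr (_ * _); apply: eq_bigr => z _; rewrite expr2.
  apply: H; rewrite /GRing.scale /= mulr0 addr0 /Gamma -mulr_sumr; ring.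
(* [derive_le] needs an upper bound on the derivative, hence the opposite sign. *)
have := @derive_le R (fun s => - act (semigroup s) (fun y => Gamma (u s) (u s) y) x)
  (fun s => - act (semigroup s) (fun y => lapl (fun y => Gamma (u s) (u s) y) y +
      (- 2 * Gamma (u s) (lapl (u s)) y)) x) 0 t 0 t0.
rewrite mul0r act_semigroup0 /u subr0 subrr.
have -> : act (semigroup 0) f = f by apply/funext => y; rewrite act_semigroup0.
move=> H; rewrite -subr_ge0 -oppr_le0 opprB addrC -[X in _ + X]opprK; apply: H => s.
  exact: is_deriveN (is_derive_interp (h := fun s y => Gamma (u s) (u s) y)
    (h' := fun s y => - 2 * Gamma (u s) (lapl (u s)) y) x (D s)).
move=> /andP[s0 _]; rewrite oppr_le0; apply: sumr_ge0 => y _.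
rewrite mulr_ge0 ?semigroup_ge0 //.
by have := K (u s) y; rewrite -/(Gamma (u s) (u s)); lra.
Qed.

(** The interpolation P_s ((P_{t-s} f)^2) runs from (P_t f)^2 to P_t (f^2); its derivative 2 P_s
    Gamma(P_{t-s} f) is at most 2 C by [Gamma_semigroup]. *)
Lemma local_poincare t f x (C : R) : 0 <= t -> (forall y, Gamma f f y <= C) ->
  \sum_y (f y - act (semigroup t) f x) ^+ 2 * semigroup t x y <= 2 * t * C.
Proof.
move=> t0 fC.
have actE g : act (semigroup t) g x = \sum_y g y * semigroup t x y.
  by apply: eq_bigr => y _; rewrite mulrC.
rewrite actE wvarE ?semigroup_sum1 // -!actE.
pose u s := act (semigroup (t - s)) f.
have D s y : is_derive s 1 (fun s => u s y ^+ 2) (- 2 * (u s y * lapl (u s) y)).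
  have := is_deriveX 2 (is_derive_act_rev f y t s).
  by move=> /is_derive_eq; apply; rewrite /GRing.scale /= /u; ring.
have := @derive_le R (fun s => act (semigroup s) (fun y => u s y ^+ 2) x)
  (fun s => act (semigroup s) (fun y => lapl (fun y => u s y ^+ 2) y +
      (- 2 * (u s y * lapl (u s) y))) x) 0 t (2 * C) t0.
rewrite subr0 act_semigroup0 /u subr0 subrr.
have -> : act (semigroup 0) f = f by apply/funext => y; rewrite act_semigroup0.
move=> H; rewrite (mulrAC 2); apply: H => s.
  exact: (is_derive_interp (h := fun s y => u s y ^+ 2)
    (h' := fun s y => - 2 * (u s y * lapl (u s) y)) x (D s)).
move=> /andP[s0 st].
rewrite -(act_sum1 (2 * C) (semigroup_sum1 s x)); apply: act_le => y.
  exact: semigroup_ge0.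
rewrite mulNr lapl_sqr ler_wpM2l ?ler0n //.
have ts : 0 <= t - s by rewrite subr_ge0.
apply: le_trans (Gamma_semigroup f y ts) _.
rewrite -(act_sum1 C (semigroup_sum1 (t - s) y)); apply: act_le => z //.
exact: semigroup_ge0.
Qed.

End NonNeg.
End Curvature.

(** * Diameter *)

Section LocalLipschitz.
Variables (R : realType) (M : markovChain R).
Local Notation P := (@trans R M).
Local Notation pi := (@stat R M).
Local Notation k := ((return_dist M)%:R : R).
Implicit Types (f g : M -> R) (x y z : M).

Let P0 := @trans_ge0 R M.
Let P1 := @trans_sum1 R M.

Lemma return_dist_ge1 : 1 <= k.
Proof. by rewrite ler1n return_dist_gt0. Qed.

Definition edge_lip (L : R) f := forall y z, 0 < P y z -> `|f y - f z| <= L.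

Lemma edge_lip_mul L f y z : edge_lip L f -> P y z * `|f z - f y| <= P y z * L.
Proof.
move=> fL; have := P0 y z; rewrite le_eqVlt => /orP[/eqP <-|yz].
  by rewrite !mul0r.
by rewrite ler_wpM2l // distrC fL.
Qed.

Lemma Gamma_lip L f x : 0 <= L -> edge_lip L f -> Gamma f f x <= 2^-1 * L ^+ 2.
Proof.
move=> L0 fL; rewrite ler_wpM2l ?invr_ge0 ?ler0n //.
rewrite -(act_sum1 (L ^+ 2) (P1 x)); apply: ler_sum => y _.
rewrite mulrC; have := P0 x y; rewrite le_eqVlt => /orP[/eqP <-|xy].
  by rewrite !mul0r.
rewrite ler_wpM2l // -expr2 -real_normK ?num_real // lerXn2r ?nnegrE //.
exact: fL.
Qed.

(** An edge raises the distance by at most 1 and, as it can be undone within k steps, lowers it by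
    at most k. *)
Lemma edge_lip_dist x0 : edge_lip k (fun y => (dist x0 y)%:R).
Proof.
move=> y z yz; have k1 := return_dist_ge1.
have A : (dist x0 z)%:R <= (dist x0 y)%:R + 1 :> R.
  rewrite natr1 ler_nat -addn1; apply: leq_trans (dist_triangle x0 y z) _.
  by rewrite leq_add2l dist_edge.
have B : (dist x0 y)%:R <= (dist x0 z)%:R + k :> R.
  rewrite -natrD ler_nat; apply: leq_trans (dist_triangle x0 z y) _.
  by rewrite leq_add2l dist_return.
by rewrite ler_norml; apply/andP; split; lra.
Qed.

Lemma act_kpow_displacement L f m x : 0 <= L -> edge_lip L f ->
  act (kpow P m) (fun y => `|f y - f x|) x <= m%:R * L.
Proof.
move=> L0 fL; elim: m x => [|m IH] x.
  by rewrite /act /= sum_eqr subrr normr0 mul0r.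
rewrite act_kpowS.
apply: le_trans (_ : act P (fun y => m%:R * L + `|f y - f x|) x <= _).
  apply: act_le => // y.
  rewrite -(act_sum1 `|f y - f x| (kpow_sum1 P1 m y)).
  apply: le_trans (_ : act (kpow P m) (fun z => `|f z - f y| + `|f y - f x|) y <= _).
    apply: act_le => z; first exact: kpow_ge0.
    exact: ler_distD.
  by rewrite actD lerD2r.
rewrite actD act_sum1 // -natr1 mulrDl mul1r lerD2l.
rewrite -[leRHS](act_sum1 L (P1 x)); apply: ler_sum => y _.
exact: edge_lip_mul.
Qed.

(** Each jump moves f by at most L, and the mean number of jumps is t. *)
Lemma act_displacement L f t x : 0 <= t -> 0 <= L -> edge_lip L f ->
  act (semigroup t) (fun y => `|f y - f x|) x <= t * L.
Proof.
move=> t0 L0 fL.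
apply: (is_pois_le t0 _ (is_pois_act t _ x) (is_pois_shift (is_pois_cst t L))) => m.
exact: act_kpow_displacement.
Qed.

Section Mixed.
Variables (t e : R).
Hypotheses (t1 : 1 <= t) (tr : trel M <= t) (e01 : 0 < e < 1).
Hypothesis tvt : forall x, tv (semigroup t x) pi <= 1 - e.

Let t0 : 0 < t. Proof. exact: lt_le_trans t1. Qed.
Let t0' : 0 <= t. Proof. exact: ltW. Qed.

(** Otherwise the semigroup at x, concentrated near f x by Markov's inequality, and pi, concentrated
    near [mean f] by Chebyshev and Poincare, would live on disjoint sets up to mass e / 4 each, so
    their distance would be at least 1 - e / 2. *)
Lemma dist_center f x : edge_lip k f ->
  `|f x - mean f| <= 8 * k * t / e.
Proof.
move=> fL; rewrite leNgt; apply/negP => far.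
have k1 := return_dist_ge1; have /andP[e0 e1] := e01.
have kt0 : 0 < k * t by rewrite mulr_gt0 // (lt_le_trans ltr01).
pose s := 4 * k * t / e.
have s0 : 0 < s by rewrite /s -mulrA -mulrA mulr_gt0 ?ltr0n // mulrA divr_gt0.
have A : \sum_(y | s <= `|f y - f x|) semigroup t x y <= e / 4.
  rewrite -(ler_pM2l s0).
  apply: le_trans (wmarkov (semigroup_ge0 t0' x) (fun y => f y - f x) s) _.
  have -> : s * (e / 4) = t * k by rewrite /s; field; rewrite gt_eqF.
  have := act_displacement x t0' (le_trans ler01 k1) fL.
  by apply: le_trans; apply: ler_sum => y _; rewrite mulrC.
have B : \sum_(y | s <= `|f y - mean f|) pi y <= e / 4.
  rewrite -(ler_pM2l (exprn_gt0 2 s0)).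
  apply: le_trans (wchebyshev (@stat_ge0 R M) f (mean f) (ltW s0)) _.
  apply: le_trans (poincare f) _.
  have En : energy f <= 2^-1 * k ^+ 2.
    have := act_sum1 (P := fun _ : M => pi) (2^-1 * k ^+ 2) (x := x) (@stat_sum1 R M).
    move=> <-; apply: ler_sum => y _; rewrite mulrC ler_wpM2l ?stat_ge0 //.
    by apply: Gamma_lip => //; exact: le_trans k1.
  have -> : s ^+ 2 * (e / 4) = (k * t) ^+ 2 * (4 / e).
    by rewrite /s; field; rewrite gt_eqF.
  apply: le_trans (_ : t * (2^-1 * k ^+ 2) <= _).
    apply: ler_pM => //; [|exact: energy_ge0].
    by apply: le_trans (trel_ge M); rewrite invr_ge0.
  apply: le_trans (_ : (k * t) ^+ 2 * 1 <= _); last first.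
    rewrite ler_wpM2l ?sqr_ge0 // ler_pdivlMr //; lra.
  rewrite mulr1 -subr_ge0.
  have -> : (k * t) ^+ 2 - t * (2^-1 * k ^+ 2) = k ^+ 2 * t * (t - 2^-1) by ring.
  by rewrite !mulr_ge0 ?sqr_ge0 //; have := t1; lra.
have C := tv_ge (fun y => ~~ (s <= `|f y - f x|))
  (etrans (semigroup_sum1 t x) (esym (@stat_sum1 R M))).
have D : \sum_(y | ~~ (s <= `|f y - f x|)) semigroup t x y =
    1 - \sum_(y | s <= `|f y - f x|) semigroup t x y.
  have := semigroup_sum1 t x.
  by rewrite (bigID (fun y => s <= `|f y - f x|)) /=; lra.
have E : \sum_(y | ~~ (s <= `|f y - f x|)) pi y <= \sum_(y | s <= `|f y - mean f|) pi y.
  rewrite big_mkcond [leRHS]big_mkcond /=; apply: ler_sum => y _.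
  case: ifPn => [yx|_]; last by case: ifP => // _; exact: stat_ge0.
  rewrite ifT //; rewrite -ltNge in yx.
  have : `|f x - mean f| <= `|f y - f x| + `|f y - mean f|.
    by rewrite (distrC (f y)) ler_distD.
  have E8 : 8 * k * t / e = s + s by rewrite /s; field; rewrite gt_eqF.
  by move: far yx; rewrite E8; lra.
have := tvt x; lra.
Qed.

Lemma diameter_le x y : (dist x y)%:R <= 16 * k / e * t.
Proof.
have A := dist_center x (edge_lip_dist x).
have B := dist_center y (edge_lip_dist x).
rewrite distxx in A; have -> : 16 * k / e * t = 8 * k * t / e + 8 * k * t / e by ring.
move: A B; rewrite !ler_norml => /andP[A1 A2] /andP[B1 B2]; lra.
Qed.

End Mixed.
End LocalLipschitz.

(** * Concentration of the log-density *)

Section LogDensity.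
Variables (R : realType) (M : markovChain R).
Local Notation P := (@trans R M).
Local Notation pi := (@stat R M).
Local Notation k := ((return_dist M)%:R : R).
Local Notation D := (Delta M).
Implicit Types (f g : M -> R) (x y z : M).

Let P0 := @trans_ge0 R M.
Let P1 := @trans_sum1 R M.

Section Fixed.
Variables (t e : R).
Hypotheses (t1 : 1 <= t) (tr : trel M <= t) (e01 : 0 < e < 1).
Hypothesis tvt : forall x, tv (semigroup t x) pi <= 1 - e.

Let t0 : 0 < t. Proof. exact: lt_le_trans t1. Qed.
Let t0' : 0 <= t. Proof. exact: ltW. Qed.

(** By [diameter_le] all distances are at most r t. *)
Let r := 16 * k / e.

Let r1 : 1 <= r.
Proof.
have /andP[e0 e1] := e01; have k1 := return_dist_ge1 M.
by rewrite /r ler_pdivlMr // mul1r; lra.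
Qed.

Let r0 : 0 < r. Proof. exact: lt_le_trans r1. Qed.
Let rD1 : 1 <= r * D. Proof. by rewrite mulr_ege1 // Delta_ge1. Qed.
Let rD0 : 0 < r * D. Proof. exact: lt_le_trans rD1. Qed.

Let p x y := semigroup t x y.
Let p0 x y : 0 < p x y. Proof. exact: semigroup_gt0. Qed.

(** Only the Poisson term of index d = [dist x y] is kept. It is at least exp(-t) t^d / (d!
    Delta^d), and d! <= d^d <= (r t)^d. *)
Lemma ln_semigroup_ge x y : - ln (p x y) <= t * (1 + r * ln (r * D)).
Proof.
set d := dist x y.
have dD : d%:R <= r * t by exact: diameter_le.
have A : (r * D) ^- d <= expR t * p x y.
  apply: le_trans (semigroup_term t0' d x y).
  rewrite exprMn invfM ler_pM ?invr_ge0 ?exprn_ge0 ?(ltW r0) ?(ltW (Delta_gt0 M)) //.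
    rewrite ler_pdivlMr ?ltr0n ?fact_gt0 // mulrC ler_pdivrMr ?exprn_gt0 //.
    rewrite -exprMn mulrC; apply: le_trans (_ : (d%:R) ^+ d <= _); last first.
      by apply: lerXn2r; rewrite ?nnegrE // mulr_ge0 // ltW.
    rewrite -natrX ler_nat; elim: (d) => // n IH.
    rewrite factS expnS leq_mul2l /=; apply: leq_trans IH _.
    by case: n => [|n] //; rewrite leq_exp2r.
  exact: kpow_dist_ge.
have B : - (ln (r * D) *+ d) <= t + ln (p x y).
  rewrite -lnXn // -lnV ?posrE ?exprn_gt0 // -[X in _ <= X + _](expRK t) -lnM ?posrE ?expR_gt0 //.
  by rewrite ler_ln ?posrE ?invr_gt0 ?exprn_gt0 // mulr_gt0 ?expR_gt0.
have C : ln (r * D) *+ d <= r * t * ln (r * D).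
  by rewrite -mulr_natl ler_wpM2r // ln_ge0.
rewrite mulrDr mulr1 mulrA (mulrC t r); lra.
Qed.

(** Chosen so that t Z bounds [expR 1 * t - ln (p x y)], the level [b] in the next lemma. *)
Let Z := expR 1 + 1 + r * ln (r * D).

Let Z1 : 1 <= Z.
Proof.
rewrite /Z addrAC lerDr addr_ge0 ?expR_ge0 // mulr_ge0 ?(ltW r0) //.
exact: ln_ge0.
Qed.

(** Let S be the mean of P^(N-1)(x, y) on N >= 1. One more jump gives S P(y, z) <= p x z. By size
    biasing, t p x y is the mean of N P^(N-1)(x, y); cutting N at b <= t Z bounds it by b S plus a
    small error, so S >= p x y / (2 Z). *)
Lemma semigroup_step x y z : p x y * P y z <= 2 * Z * p x z.
Proof.
pose a m : R := if m is m'.+1 then kpow P m' x y else 0.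
have a01 m : 0 <= a m <= 1 by case: m => [|m] /=; rewrite ?lexx ?ler01 // kpow_ge0 // kpow_le1.
have aS : is_pois t a (pois t a).
  by apply: (@is_poisP _ t a 1) => m; have /andP[u v] := a01 m; rewrite ger0_norm.
set S := pois t a in aS.
have S0 : 0 <= S.
  by apply: is_pois_le t0' _ (is_pois_cst t 0) aS => m; have /andP[] := a01 m.
have SP : S * P y z <= p x z.
  rewrite mulrC; apply: is_pois_le t0' _ (is_poisZ (P y z) aS) (is_pois_sg t x z) => m.
  case: m => [|m]; first by rewrite mulr0 kpow_ge0.
  by have := kpow_ge P0 m 1 x y z; rewrite kpow1 addn1 mulrC.
(* [b] is chosen so that [exp (- b) * E(exp N) <= p x y * exp (- t)], where N
   is the Poisson number of jumps. *)
pose b := expR 1 * t - ln (p x y).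
have p1 : p x y <= 1.
  rewrite -(semigroup_sum1 t x) (bigD1 y) //= lerDl.
  by apply: sumr_ge0 => w _; exact: ltW.
have b0 : 0 < b by rewrite /b ltr_wpDr ?oppr_ge0 ?ln_le0 // mulr_gt0 ?expR_gt0.
(* The excess (N - b) P^(N-1)(x, y) is at most exp(N - b), whose mean is the error term. *)
have E : t * p x y <= b * S + p x y * expR (- t).
  have -> : p x y * expR (- t) = expR (- b) * expR (t * (expR 1 - 1)).
    rewrite -expRD /b -{1}(lnK (p0 x y)) -expRD; congr expR; ring.
  apply: is_pois_le t0' _ (is_pois_shift (is_pois_sg t x y))
    (is_poisD (is_poisZ b aS) (is_poisZ (expR (- b)) (is_pois_geo t (expR 1)))) => m.
  case: m => [|m]; first by rewrite mul0r mulr0 add0r mulr_ge0 ?expR_ge0 // exprn_ge0 ?expR_ge0.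
  have /andP[u v] := a01 m.+1.
  have -> : m.+1%:R * kpow P m.+1.-1 x y = b * a m.+1 + (m.+1%:R - b) * a m.+1 by rewrite /=; ring.
  rewrite lerD2l -expRM_natl mulr1 -expRD (addrC _ (- b)).
  apply: le_trans (_ : expR (- b + m.+1%:R) * a m.+1 <= _).
    by rewrite ler_wpM2r //; have := expR_ge1Dx (- b + m.+1%:R); lra.
  by rewrite ler_piMr ?expR_ge0.
have bZ : b <= t * Z.
  have := ln_semigroup_ge x y; rewrite /b.
  have -> : t * Z = expR 1 * t + t * (1 + r * ln (r * D)) by rewrite /Z; ring.
  lra.
have et : expR (- t) <= 2^-1.
  rewrite expRN lef_pV2 ?posrE ?expR_gt0 //; have A := expR_ge1Dx t.
  by apply: le_trans A; rewrite -[leLHS]/(1 + 1) lerD2l.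
have pS : p x y <= 2 * Z * S.
  have H1 : p x y * expR (- t) <= p x y * 2^-1 by rewrite ler_wpM2l // ltW.
  have H2 : b * S <= t * Z * S by rewrite ler_wpM2r.
  have H3 : t * p x y * 2^-1 <= t * Z * S.
    have : p x y * 2^-1 <= t * p x y * 2^-1 by rewrite ler_wpM2r // ler_peMl // ltW.
    lra.
  rewrite -(ler_pM2l t0); have -> : t * (2 * Z * S) = 2 * (t * Z * S) by ring.
  lra.
apply: le_trans (_ : 2 * Z * S * P y z <= _); first by rewrite ler_wpM2r.
by rewrite -mulrA ler_wpM2l // mulr_ge0 // (le_trans _ Z1).
Qed.

Let h x y := ln (p x y) - ln (pi y).

(** Forwards an edge loses at most a factor c; backwards it is undone by a path of at most k steps,
    which loses at most c^k. *)
Lemma edge_lip_ln (c : R) (phi : M -> R) : 0 < c <= 1 -> (forall y, 0 < phi y) ->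
  (forall y z, 0 < P y z -> y != z -> c * phi y <= phi z) ->
  edge_lip (- (k * ln c)) (fun y => ln (phi y)).
Proof.
move=> /andP[c0 c1] ph0 H y z yz.
have A := edge_propagate (phi := phi) (c := c).
have step m u v : 0 < kpow P m u v -> m%:R * ln c + ln (phi u) <= ln (phi v).
  move=> uv; have := A m u v _ (fun x => ltW (ph0 x)) H uv; rewrite (ltW c0) c1 => /(_ isT).
  rewrite -ler_ln ?posrE ?mulr_gt0 ?exprn_gt0 // lnM ?posrE ?exprn_gt0 // lnXn //.
  by rewrite mulr_natl.
have lc : ln c <= 0 by exact: ln_le0.
have dk u v : (dist u v <= return_dist M)%N -> k * ln c + ln (phi u) <= ln (phi v).
  move=> d; apply: le_trans (step _ _ _ (dist_gt0 u v)).
  by rewrite lerD2r ler_wnM2r // ler_nat.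
rewrite ler_norml; apply/andP; split.
  have : k * ln c + ln (phi y) <= ln (phi z) .
    by apply: dk; apply: leq_trans (dist_edge yz) (return_dist_gt0 M).
  by have := dk z y (dist_return yz); lra.
have := dk y z (leq_trans (dist_edge yz) (return_dist_gt0 M)); lra.
Qed.

Lemma edge_lip_log_density x :
  edge_lip (k * (ln 2 + ln Z + 2 * ln D)) (h x).
Proof.
have D1 := Delta_ge1 M; have D0 := Delta_gt0 M.
have Z0 : 0 < Z by exact: lt_le_trans Z1.
(* Along an edge P is at least 1 / Delta. With [semigroup_step] this gives the factor for [p x]; for
   pi, invariance gives 1 / Delta. *)
have c0 : 0 < (2 * Z * D)^-1 by rewrite invr_gt0 !mulr_gt0.
have A : edge_lip (- (k * ln (2 * Z * D)^-1)) (fun y => ln (p x y)).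
  apply: edge_lip_ln => //.
    rewrite c0 invf_le1 ?mulr_gt0 //; have := Z1; nra.
  move=> y z yz ne; rewrite mulrC ler_pdivrMr ?mulr_gt0 //.
  have := semigroup_step x y z; have := Delta_edge yz ne.
  rewrite -[_ <= P y z](ler_pM2l D0) divff ?gt_eqF // => H1 H2.
  have : p x y * 1 <= p x y * (D * P y z) by rewrite ler_wpM2l // ltW.
  have : D * (p x y * P y z) <= D * (2 * Z * p x z) by rewrite ler_wpM2l // ltW.
  lra.
have B : edge_lip (- (k * ln D^-1)) (fun y => ln (pi y)).
  apply: edge_lip_ln => [|y|y z yz ne]; rewrite ?stat_gt0 //.
    by rewrite invr_gt0 D0 invf_le1.
  rewrite -(@stat_inv R M z) (bigD1 y) //= -[leLHS]addr0 lerD //.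
    by rewrite mulrC ler_wpM2l ?stat_ge0 // Delta_edge.
  by apply: sumr_ge0 => w _; rewrite mulr_ge0 ?stat_ge0.
move=> y z yz; have := A y z yz; have := B y z yz; rewrite /h /=.
have q1 : 0 < 2 * Z by rewrite mulr_gt0.
have q2 : 0 < 2 * Z * D by rewrite mulr_gt0.
rewrite !lnV ?posrE // (@lnM _ (2 * Z)) ?posrE // (@lnM _ 2) ?posrE // !ler_norml.
move=> /andP[u1 u2] /andP[v1 v2]; apply/andP; split; lra.
Qed.

(** One factor k comes from undoing edges; the other absorbs ln Z, which is at most linear in k and
    1 + ln Delta because ln u < u. *)
Definition log_lip : R := (expR 1 + 8 + 32 / e) * (k ^+ 2 * (1 + ln D)).

Lemma log_lip_ge x : edge_lip log_lip (h x).
Proof.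
move=> y z yz; apply: le_trans (edge_lip_log_density x yz) _.
have k1 := return_dist_ge1 M; have /andP[e0 e1] := e01.
have k0 : 0 < k by exact: lt_le_trans k1.
have l0 : 0 <= ln D by rewrite ln_ge0 // Delta_ge1.
set l := 1 + ln D; have l1 : 1 <= l by rewrite lerDl.
have Zle : Z <= (expR 1 + 3) * (r ^+ 2 * l).
  have lr : ln r <= r by rewrite ltW // ln_sublinear.
  have r2 : 1 <= r ^+ 2 by rewrite exprn_ege1.
  have rr : r <= r ^+ 2 by rewrite expr2 ler_peMl // ltW.
  have H : r * ln (r * D) <= r ^+ 2 + r ^+ 2 * l.
    rewrite lnM ?posrE ?Delta_gt0 // mulrDr lerD //.
      by rewrite expr2 ler_wpM2l // ltW.
    by rewrite ler_pM // ?(ltW r0) // /l; lra.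
  have H2 : r ^+ 2 <= r ^+ 2 * l by rewrite ler_peMr // (le_trans _ r2).
  have : (expR 1 + 1) * 1 <= (expR 1 + 1) * (r ^+ 2 * l).
    by rewrite ler_wpM2l ?addr_ge0 ?expR_ge0 // (le_trans r2).
  rewrite /Z; lra.
have ln2 : ln (2 : R) <= 1 by apply: (@le_ln1Dx R 1); lra.
have lnZ : ln Z <= expR 1 + 2 + 2 * (16 / e) + 2 * k + l.
  have e3 : 0 < expR 1 + 3 :> R by rewrite addr_gt0 ?expR_gt0.
  have l0' : 0 < l by exact: lt_le_trans l1.
  apply: le_trans (_ : ln ((expR 1 + 3) * (r ^+ 2 * l)) <= _).
    rewrite ler_ln ?posrE ?(lt_le_trans _ Z1) //.
    by apply: mulr_gt0 => //; apply: mulr_gt0 => //; exact: exprn_gt0.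
  have r2l : 0 < r ^+ 2 * l by apply: mulr_gt0 => //; exact: exprn_gt0.
  rewrite (lnM (x := expR 1 + 3)) ?posrE // (lnM (x := r ^+ 2)) ?posrE ?exprn_gt0 // lnXn //.
  have -> : r = 16 / e * k by rewrite /r; ring.
  rewrite lnM ?posrE ?divr_gt0 // mulr2n.
  have h1 : ln (1 + (expR 1 + 2)) <= expR 1 + 2 :> R.
    by apply: le_ln1Dx; have := expR_gt0 (1 : R); lra.
  have h2 : ln (16 / e) <= 16 / e by rewrite ltW // ln_sublinear // divr_gt0.
  have h3 := ln_sublinear k0.
  have h4 := ln_sublinear l0'.
  have -> : expR 1 + 3 = 1 + (expR 1 + 2) :> R by ring.
  lra.
rewrite /log_lip -/l.
set C := expR 1 + 8 + 32 / e.
have kl : k * 1 <= k * l by rewrite ler_wpM2l // ltW.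
have kl' : 1 * l <= k * l by rewrite ler_wpM2r // (le_trans _ l1).
have -> : C * (k ^+ 2 * l) = k * (C * (k * l)) by ring.
apply: ler_wpM2l; first exact: ltW.
have C1 : (expR 1 + 3 + 2 * (16 / e)) * 1 <= (expR 1 + 3 + 2 * (16 / e)) * (k * l).
  rewrite ler_wpM2l //; last by nra.
  have := expR_gt0 (1 : R); have := divr_gt0 (ltr0n R 16 : 0 < 16) e0; lra.
have -> : C * (k * l) = (expR 1 + 3 + 2 * (16 / e)) * (k * l) + 5 * (k * l) by rewrite /C; ring.
have : ln D <= l by rewrite /l; lra.
lra.
Qed.

Hypothesis K : forall f x, Gamma f (lapl f) x <= 2^-1 * lapl (Gamma f f) x.

(** By Chebyshev and [local_poincare], [h x] exceeds its mean m by s2 only on mass eta, and m is at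
    most s1 + ln (2 / e) because p and pi overlap. *)
Lemma density_concentration (eta : R) x : 0 < eta <= 1 ->
  \sum_(y | expR (log_lip * Num.sqrt t * (2 / e + 1 / eta) + ln (2 / e)) * pi y < p x y) p x y
  <= eta.
Proof.
move=> /andP[eta0 eta1]; have /andP[e0 e1] := e01.
have st0 : 0 < Num.sqrt t by rewrite sqrtr_gt0.
have st : Num.sqrt t ^+ 2 = t by rewrite sqr_sqrtr.
have L0 : 0 < log_lip.
  have k1 := return_dist_ge1 M; have k0 : 0 < k by exact: lt_le_trans k1.
  rewrite /log_lip mulr_gt0 //.
    by have := expR_gt0 (1 : R); have := divr_gt0 (ltr0n R 32 : 0 < 32) e0; lra.
  rewrite mulr_gt0 ?exprn_gt0 //; have := ln_ge0 (Delta_ge1 M); lra.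
set m := act (semigroup t) (h x) x.
have V0 : 0 <= t * log_lip ^+ 2 := mulr_ge0 t0' (sqr_ge0 _).
have V : \sum_y (h x y - m) ^+ 2 * p x y <= t * log_lip ^+ 2.
  have -> : t * log_lip ^+ 2 = 2 * t * (2^-1 * log_lip ^+ 2) by field.
  apply: local_poincare => // y; apply: Gamma_lip; first exact: ltW.
  exact: log_lip_ge.
have cheb s q : 0 < s -> 0 < q -> t * log_lip ^+ 2 <= q * s ^+ 2 ->
    \sum_(y | s <= `|h x y - m|) p x y <= q.
  move=> s0 q0 H; rewrite -(ler_pM2l (exprn_gt0 2 s0)) [leRHS]mulrC.
  apply: le_trans H; apply: le_trans V.
  by apply: wchebyshev (ltW s0) => y; exact: ltW.
(* Chebyshev would allow the factors sqrt (2 / e) and sqrt (1 / eta); both radicands are at least 1,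
   so dropping the roots only enlarges s1 and s2. *)
pose s1 := log_lip * Num.sqrt t * (2 / e).
pose s2 := log_lip * Num.sqrt t * (1 / eta).
have Ls : 0 < log_lip * Num.sqrt t := mulr_gt0 L0 st0.
have s10 : 0 < s1 by apply: mulr_gt0 Ls _; rewrite divr_gt0.
have s20 : 0 < s2 by apply: mulr_gt0 Ls _; rewrite divr_gt0.
have B1 : \sum_(y | s1 <= `|h x y - m|) p x y <= e / 2.
  apply: cheb; rewrite ?divr_gt0 //.
  have -> : e / 2 * s1 ^+ 2 = Num.sqrt t ^+ 2 * log_lip ^+ 2 * (2 / e).
    by rewrite /s1; field; rewrite gt_eqF.
  rewrite st.
  rewrite ler_peMr // ler_pdivlMr //; lra.
have B2 : \sum_(y | s2 <= `|h x y - m|) p x y <= eta.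
  apply: cheb => //.
  have -> : eta * s2 ^+ 2 = Num.sqrt t ^+ 2 * log_lip ^+ 2 * (1 / eta).
    by rewrite /s2; field; rewrite gt_eqF.
  rewrite st.
  by rewrite ler_peMr // ler_pdivlMr // mul1r.
have hE y : p x y = expR (h x y) * pi y.
  by rewrite /h expRB !lnK ?posrE ?stat_gt0 // divfK // gt_eqF // stat_gt0.
(* Where h is within s1 of m, pi = exp(- h) p <= exp(s1 - m) p. This set has p-mass at least 1 - e /
   2, and a distance of at most 1 - e forces its pi-mass to be at least e / 2. *)
have Hm : m - s1 <= ln (2 / e).
  have C := tv_ge (fun y => ~~ (s1 <= `|h x y - m|))
    (etrans (semigroup_sum1 t x) (esym (@stat_sum1 R M))).
  have Dq : \sum_(y | ~~ (s1 <= `|h x y - m|)) semigroup t x y =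
      1 - \sum_(y | s1 <= `|h x y - m|) semigroup t x y.
    have := semigroup_sum1 t x.
    by rewrite (bigID (fun y => s1 <= `|h x y - m|)) /=; lra.
  have E : \sum_(y | ~~ (s1 <= `|h x y - m|)) pi y <= expR (s1 - m).
    rewrite -[leRHS]mulr1 -(semigroup_sum1 t x) mulr_sumr big_mkcond /=.
    apply: ler_sum => y _; have q := stat_ge0 y; case: ifPn; last first.
      by rewrite mulr_ge0 ?expR_ge0 // ltW.
    rewrite -ltNge ltr_norml => /andP[u _].
    rewrite -/(p x y) hE mulrA -expRD ler_peMl //.
    by rewrite -expR0 ler_expR; lra.
  have F : e / 2 <= expR (s1 - m) by have := tvt x; lra.
  have : ln (e / 2) <= s1 - m by rewrite -ler_expR lnK ?posrE ?divr_gt0.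
  by rewrite -[2 / e]invf_div lnV ?posrE ?divr_gt0 //; lra.
apply: le_trans B2; rewrite big_mkcond [leRHS]big_mkcond /=.
apply: ler_sum => y _; case: ifPn => [H|_]; last by case: ifP => // _; exact: ltW.
rewrite ifT //; move: H; rewrite {1}hE ltr_pM2r ?stat_gt0 // ltr_expR mulrDr.
rewrite -/s1 -/s2 => H; apply: le_trans (ler_norm _); lra.
Qed.

End Fixed.
End LogDensity.

(** * L2 contraction in discrete time *)

Section Contraction.
Variables (R : realType) (M : markovChain R) (delta : R).
Local Notation P := (@trans R M).
Local Notation pi := (@stat R M).
Implicit Types (f g nu : M -> R) (x y z : M).
Hypotheses (d01 : 0 < delta < 1) (lazyM : is_lazy M delta).

Let P0 := @trans_ge0 R M.
Let P1 := @trans_sum1 R M.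
Let pi0 := @stat_ge0 R M.
Let pi1 := @stat_sum1 R M.
Let pip := @stat_gt0 R M.

Definition dens nu y : R := nu y / pi y.
Definition push (Q : M -> M -> R) nu y : R := \sum_x nu x * Q x y.

Lemma mean_dens nu : mean (dens nu) = \sum_y nu y.
Proof. by apply: eq_bigr => y _; rewrite divfK // gt_eqF. Qed.

Lemma push_sum Q nu : (forall x, \sum_y Q x y = 1) -> \sum_y push Q nu y = \sum_y nu y.
Proof.
move=> Q1; rewrite exchange_big /=; apply: eq_bigr => x _.
by rewrite -mulr_sumr Q1 mulr1.
Qed.

Lemma push_kpowS m nu y : push (kpow P m.+1) nu y = push P (push (kpow P m) nu) y.
Proof.
rewrite /push; under eq_bigr do rewrite kpowSr mulr_sumr.
rewrite exchange_big /=; apply: eq_bigr => z _.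
by rewrite mulr_suml; apply: eq_bigr => x _; rewrite mulrA.
Qed.

(* The density of [push P nu] at z is an average of the density of nu with
   respect to the time-reversed kernel. *)
Lemma var_dens_push nu :
  var (dens (push P nu)) <= var (dens nu) - delta * energy (dens nu).
Proof.
have /andP[d0 d1] := d01.
set g := dens nu; set g' := dens (push P nu).
have mE : mean g' = mean g by rewrite !mean_dens push_sum.
pose w z x := pi x * P x z / pi z.
have w0 z x : 0 <= w z x by rewrite /w !mulr_ge0 ?invr_ge0.
have w1 z : \sum_x w z x = 1.
  by rewrite /w -mulr_suml stat_inv divff // gt_eqF.
have g'E z : g' z = \sum_x g x * w z x.
  rewrite /g' /dens /push mulr_suml; apply: eq_bigr => x _.
  by rewrite /w /g /dens; field; rewrite !gt_eqF.
pose V z := \sum_x (g x - g' z) ^+ 2 * w z x.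
have sumw (F : M -> M -> R) :
    \sum_z (\sum_x F x z * w z x) * pi z = \sum_x \sum_z F x z * (pi x * P x z).
  rewrite [RHS]exchange_big /=; apply: eq_bigr => z _.
  rewrite mulr_suml; apply: eq_bigr => x _; rewrite /w; field.
  by rewrite gt_eqF.
(* The law of total variance; V is the conditional variance lost in one step. *)
have decomp : var g = \sum_z V z * pi z + var g'.
  have -> : var g = \sum_z (\sum_x (g x - mean g) ^+ 2 * w z x) * pi z.
    rewrite (sumw (fun x _ => (g x - mean g) ^+ 2)); apply: eq_bigr => x _.
    by rewrite -mulr_sumr -mulr_sumr P1 mulr1.
  rewrite -big_split /=; apply: eq_bigr => z _.
  by rewrite (wvar_shift _ _ (w1 z)) -g'E mE mulrDl.
(* Recentring from g' z to g z adds (g' z - g z)^2, which laziness controls through w z z = P z z >=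
   delta. *)
have Vge z : delta * \sum_x (g x - g z) ^+ 2 * w z x <= 2 * V z.
  rewrite (wvar_shift _ _ (w1 z)) -g'E -/(V z).
  have V0 : 0 <= V z by apply: sumr_ge0 => x _; rewrite mulr_ge0 ?sqr_ge0.
  have : delta * (g' z - g z) ^+ 2 <= V z.
    rewrite /V (bigD1 z) //= -[leLHS]addr0 lerD //; last first.
      by apply: sumr_ge0 => x _; rewrite mulr_ge0 ?sqr_ge0.
    rewrite -sqrrN opprB mulrC ler_wpM2l ?sqr_ge0 // /w mulrAC divff ?gt_eqF // mul1r.
    exact: lazyM.
  have : delta * V z <= V z by rewrite ler_piMl // ltW.
  rewrite mulrDr; lra.
have En : 2 * energy g = \sum_z (\sum_x (g x - g z) ^+ 2 * w z x) * pi z.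
  rewrite (sumw (fun x z => (g x - g z) ^+ 2)) mulr_sumr; apply: eq_bigr => x _.
  rewrite /Gamma -(mulrA 2^-1) [LHS]mulrA divff ?pnatr_eq0 // mul1r mulr_suml.
  by apply: eq_bigr => z _; ring.
rewrite decomp -subr_ge0.
suff : delta * (2 * energy g) <= 2 * \sum_z V z * pi z by lra.
rewrite En !mulr_sumr; apply: ler_sum => z _.
by rewrite mulrA [leRHS]mulrA ler_wpM2r.
Qed.

(** By the Poincare inequality each step multiplies the variance by at most 1 - delta / trel <=
    exp(- delta / trel). *)
Lemma var_dens_kpow nu m : var (dens (push (kpow P m) nu)) <=
  expR (- (m%:R * delta / trel M)) * var (dens nu).
Proof.
have /andP[d0 d1] := d01.
have tr0 : 0 < trel M by apply: lt_le_trans (trel_ge M); rewrite invr_gt0.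
elim: m => [|m IH].
  rewrite !mul0r oppr0 expR0 mul1r (_ : push _ nu = nu) //.
  apply/funext => y; rewrite /push /= -[RHS](sum_eqr y).
  by apply: eq_bigr => x _; rewrite mulrC eq_sym.
have -> : push (kpow P m.+1) nu = push P (push (kpow P m) nu).
  by apply/funext => y; exact: push_kpowS.
set G := push (kpow P m) nu in IH *.
apply: le_trans (var_dens_push G) _.
have v0 : 0 <= var (dens G) by apply: sumr_ge0 => y _; rewrite mulr_ge0 ?sqr_ge0.
have A : delta / trel M * var (dens G) <= delta * energy (dens G).
  rewrite -mulrA; apply: ler_wpM2l; first exact: ltW.
  by rewrite mulrC ler_pdivrMr // mulrC poincare.
have -> : - (m.+1%:R * delta / trel M) = - (delta / trel M) - m%:R * delta / trel M.
  by rewrite -natr1; ring.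
rewrite expRD -mulrA; apply: le_trans (ler_wpM2l (expR_ge0 _) IH).
apply: le_trans (_ : (1 - delta / trel M) * var (dens G) <= _).
  by rewrite mulrBl mul1r lerD2l lerN2.
rewrite ler_wpM2r //; exact: expR_ge1Dx.
Qed.

Lemma var_dens_le nu B : (forall y, 0 <= nu y <= B * pi y) -> 0 <= B ->
  var (dens nu) <= B ^+ 2.
Proof.
move=> nuB B0; apply: le_trans (wvar_le _ 0 pi1) _.
rewrite -[leRHS]mulr1 -pi1 mulr_sumr; apply: ler_sum => y _.
have /andP[n0 nB] := nuB y.
rewrite subr0 ler_wpM2r // lerXn2r ?nnegrE // /dens ?divr_ge0 //.
by rewrite ler_pdivrMr.
Qed.

(** The inequality |u| <= u^2 / (2 s) + s / 2, integrated against pi, takes the place of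
    Cauchy-Schwarz. *)
Lemma l1_le_var nu (s : R) : 0 < s -> var (dens nu) <= s ^+ 2 ->
  \sum_y `|nu y - (\sum_z nu z) * pi y| <= s.
Proof.
move=> s0 vs; set c := \sum_z nu z.
have step y : `|nu y - c * pi y| <=
    (2 * s)^-1 * ((dens nu y - c) ^+ 2 * pi y) + s / 2 * pi y.
  have -> : nu y - c * pi y = (dens nu y - c) * pi y.
    by rewrite mulrBl /dens divfK // gt_eqF.
  rewrite normrM (ger0_norm (pi0 y)) mulrA -mulrDl ler_wpM2r //.
  set u := dens nu y - c; rewrite -[u ^+ 2]real_normK ?num_real //.
  have -> : (2 * s)^-1 * `|u| ^+ 2 + s / 2 =
      `|u| + (2 * s)^-1 * (`|u| - s) ^+ 2 by field; rewrite gt_eqF.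
  by rewrite lerDl mulr_ge0 ?sqr_ge0 // invr_ge0 mulr_ge0 // ltW.
apply: le_trans (ler_sum _ (fun y _ => step y)) _.
rewrite big_split /= -!mulr_sumr pi1 mulr1.
have -> : \sum_y (dens nu y - c) ^+ 2 * pi y = var (dens nu) by rewrite /var mean_dens.
apply: le_trans (_ : (2 * s)^-1 * s ^+ 2 + s / 2 <= _).
  by rewrite lerD2r ler_wpM2l // invr_ge0 mulr_ge0 // ltW.
by rewrite le_eqVlt; apply/orP; left; apply/eqP; field; rewrite gt_eqF.
Qed.

(** The restriction of nu to A has density at most B and is contracted in L2; the rest has mass at
    most q, which enters the l1 distance at most twice. *)
Lemma tv_push_le (nu : M -> R) (A : pred M) (B q s : R) m :
  (forall y, 0 <= nu y) -> \sum_y nu y = 1 ->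
  (forall y, A y -> nu y <= B * pi y) -> \sum_(y | ~~ A y) nu y <= q ->
  0 <= B -> 0 < s -> expR (- (m%:R * delta / trel M)) * B ^+ 2 <= s ^+ 2 ->
  tv (push (kpow P m) nu) pi <= s / 2 + q.
Proof.
move=> nu0 nu1 nuB nuq B0 s0 H.
pose nu1' y := if A y then nu y else 0; pose nu2 y := if A y then 0 else nu y.
have nuE y : nu y = nu1' y + nu2 y by rewrite /nu1' /nu2; case: ifP; rewrite ?addr0 ?add0r.
have n20 y : 0 <= nu2 y by rewrite /nu2; case: ifP.
have kq y : 0 <= push (kpow P m) nu2 y.
  by apply: sumr_ge0 => x _; rewrite mulr_ge0 // kpow_ge0.
have S1 : \sum_y push (kpow P m) nu1' y = \sum_y nu1' y.
  by apply: push_sum => x; exact: kpow_sum1.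
have S2 : \sum_y push (kpow P m) nu2 y = \sum_y nu2 y.
  by apply: push_sum => x; exact: kpow_sum1.
have c2 : \sum_y nu2 y <= q.
  by rewrite (eq_bigr (fun y => if ~~ A y then nu y else 0)) -?big_mkcond // => y _; rewrite /nu2; case: (A y).
have c2' : 0 <= \sum_y nu2 y by apply: sumr_ge0.
have cE : \sum_y nu1' y + \sum_y nu2 y = 1.
  by rewrite -big_split /= -nu1; apply: eq_bigr => y _; rewrite nuE.
have L1 : \sum_y `|push (kpow P m) nu1' y - (\sum_z nu1' z) * pi y| <= s.
  rewrite -S1; apply: l1_le_var => //; apply: le_trans (var_dens_kpow _ _) _.
  apply: le_trans H; rewrite ler_wpM2l ?expR_ge0 //; apply: var_dens_le => // y.
  rewrite /nu1'; case: ifP => [/nuB -> |_]; first by rewrite nu0.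
  by rewrite lexx mulr_ge0.
rewrite /tv ler_pdivrMl ?ltr0n //.
apply: le_trans (_ : s + 2 * \sum_y nu2 y <= _); last by lra.
apply: le_trans (_ : \sum_y (`|push (kpow P m) nu1' y - (\sum_z nu1' z) * pi y| +
    (push (kpow P m) nu2 y + (\sum_z nu2 z) * pi y)) <= _).
  apply: ler_sum => y _.
  have -> : push (kpow P m) nu y - pi y =
     (push (kpow P m) nu1' y - (\sum_z nu1' z) * pi y) +
     (push (kpow P m) nu2 y - (\sum_z nu2 z) * pi y).
    rewrite -[pi y]mul1r -{1}cE mulrDl.
    have -> : push (kpow P m) nu y = push (kpow P m) nu1' y + push (kpow P m) nu2 y.
      by rewrite -big_split /=; apply: eq_bigr => x _; rewrite nuE mulrDl.
    ring.
  apply: le_trans (ler_normD _ _) _; rewrite lerD2l.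
  apply: le_trans (ler_normB _ _) _.
  by rewrite !ger0_norm ?mulr_ge0.
rewrite !big_split /= S2 -mulr_sumr pi1 mulr1; lra.
Qed.

End Contraction.

(** * Binomial powers dominated by the semigroup *)

Section Domination.
Variable R : realType.

(** The weights a^i / i! are largest at i = a. *)
Lemma expn_fact_mode (a i : nat) : (a ^ i * a`! <= a ^ a * i`!)%N.
Proof.
case: (leqP i a) => [ia|/ltnW ai].
  suff H d : (i + d <= a)%N -> (a ^ i * (i + d)`! <= a ^ (i + d) * i`!)%N.
    by have := H (a - i)%N; rewrite subnKC //; apply.
  elim: d => [|d IH] ida; first by rewrite addn0.
  rewrite addnS factS expnS.
  have ida' : (i + d <= a)%N by apply: leq_trans ida; rewrite addnS.
  apply: leq_trans (_ : a * (a ^ i * (i + d)`!) <= _)%N.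
    by rewrite mulnCA leq_mul2r -addnS ida orbT.
  by rewrite -mulnA leq_mul2l IH // orbT.
rewrite -(subnKC ai); move: (i - a)%N => d.
elim: d => [|d IH]; first by rewrite addn0.
rewrite addnS factS expnS.
apply: leq_trans (_ : a * (a ^ a * (a + d)`!) <= _)%N.
  by rewrite -mulnA leq_mul2l IH orbT.
by rewrite [leqRHS]mulnCA leq_mul2r ltnW ?orbT // ltnS leq_addr.
Qed.

(* The exponent n + 1, instead of the sharp n + 1/2, makes this sequence
   decreasing by [1 + x <= expR x] alone. *)
Definition stirling_ratio n : R := n`!%:R * expR 1 ^+ n / n%:R ^+ n.+1.

Lemma stirling_ratioS n : (0 < n)%N -> stirling_ratio n.+1 <= stirling_ratio n.
Proof.
move=> n0; have n0R : 0 < n%:R :> R by rewrite ltr0n.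
have nS0 : 0 < n.+1%:R :> R by rewrite ltr0n.
have E : expR 1 * n%:R ^+ n.+1 <= n.+1%:R ^+ n.+1 :> R.
  have -> : expR 1 = expR (n.+1%:R^-1) ^+ n.+1 :> R.
    by rewrite -expRM_natl divff // gt_eqF.
  rewrite -exprMn; apply: lerXn2r; rewrite ?nnegrE ?mulr_ge0 ?expR_ge0 //.
  rewrite -ler_pdivlMl ?expR_gt0 // -expRN mulrC -ler_pdivrMl //.
  apply: le_trans (expR_ge1Dx _).
  rewrite ler_pdivrMl // mulrBr mulr1 divff ?gt_eqF // -natr1; lra.
have -> : stirling_ratio n.+1 = n`!%:R * expR 1 ^+ n * (expR 1 / n.+1%:R ^+ n.+1).
  rewrite /stirling_ratio factS natrM !exprS; field.
  by rewrite gt_eqF //= expf_neq0 // gt_eqF.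
rewrite /stirling_ratio ler_wpM2l ?mulr_ge0 ?exprn_ge0 ?expR_ge0 //.
by rewrite ler_pdivrMr ?exprn_gt0 // ler_pdivlMl ?exprn_gt0 // mulrC.
Qed.

Lemma stirling_ratio_le a m : (0 < a <= m)%N -> stirling_ratio m <= stirling_ratio a.
Proof.
move=> /andP[a0 am]; rewrite -(subnKC am); elim: (m - a)%N => [|d IH].
  by rewrite addn0.
rewrite addnS; apply: le_trans IH; apply: stirling_ratioS.
by rewrite ltn_addr.
Qed.

(* For m < j the subtraction is truncated, but then 'C(m, j) = 0. *)
Definition bin_coef (p q : R) m j : R := 'C(m, j)%:R * p ^+ j * q ^+ (m - j).

(** Binomial against Poisson weights of equal mean. With i = m - j failures, of mean a, the ratio is
    (m! / m^m) (a^i / i!) exp(m - a). It is largest at i = a, where [stirling_ratio_le] bounds it by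
    m / a = L. *)
Lemma bin_coef_le (L a j m : nat) (p : R) : (1 < L)%N -> (0 < a)%N ->
  m = (L * a)%N -> p = 1 - L%:R^-1 ->
  bin_coef p L%:R^-1 m j <= L%:R * (expR (- (p * m%:R)) * (p * m%:R) ^+ j / j`!%:R).
Proof.
move=> L1 a0 mLa pE.
have L0 : 0 < L%:R :> R by rewrite ltr0n ltnW.
have aR : 0 < a%:R :> R by rewrite ltr0n.
have m0 : (0 < m)%N by rewrite mLa muln_gt0 (ltnW L1).
have mR : 0 < m%:R :> R by rewrite ltr0n.
have p0 : 0 <= p by rewrite pE subr_ge0 invf_le1 // ler1n ltnW.
have mE : m%:R = L%:R * a%:R :> R by rewrite mLa natrM.
case: (leqP j m) => [jm|mj]; last first.
  rewrite /bin_coef bin_small // mul0r mul0r !mulr_ge0 ?invr_ge0 ?expR_ge0 ?exprn_ge0 ?mulr_ge0 //.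
set i := (m - j)%N.
have f0 n : 0 < n`!%:R :> R by rewrite ltr0n fact_gt0.
have CE : 'C(m, j)%:R = m`!%:R / (j`!%:R * i`!%:R) :> R.
  by rewrite -(bin_fact jm) !natrM mulfK // mulf_neq0 // gt_eqF.
have qE : L%:R^-1 = a%:R / m%:R :> R by rewrite mE; field; rewrite !gt_eqF.
have expE : expR (- (p * m%:R)) = expR 1 ^+ a / expR 1 ^+ m :> R.
  rewrite -!expRM_natl !mulr1 -expRB; congr expR.
  by rewrite pE mulrBl mul1r qE divfK ?gt_eqF // opprB.
have S : m`!%:R * expR 1 ^+ m / m%:R ^+ m <= L%:R * (a`!%:R * expR 1 ^+ a / a%:R ^+ a) :> R.
  have am : (0 < a <= m)%N by rewrite a0 mLa leq_pmull // ltnW.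
  have := stirling_ratio_le am.
  rewrite /stirling_ratio -(ler_pM2l mR).
  have -> : m%:R * (m`!%:R * expR 1 ^+ m / m%:R ^+ m.+1) = m`!%:R * expR 1 ^+ m / m%:R ^+ m :> R.
    by rewrite exprS; field; rewrite !expf_neq0 ?gt_eqF.
  have -> : m%:R * (a`!%:R * expR 1 ^+ a / a%:R ^+ a.+1) = L%:R * (a`!%:R * expR 1 ^+ a / a%:R ^+ a) :> R.
    by rewrite mE exprS; field; rewrite !expf_neq0 ?gt_eqF.
  by [].
have mode : a%:R ^+ i / i`!%:R <= a%:R ^+ a / a`!%:R :> R.
  rewrite ler_pdivrMr // mulrAC ler_pdivlMr // -!natrX -!natrM ler_nat.
  exact: expn_fact_mode.
have -> : bin_coef p L%:R^-1 m j =
    p ^+ j / j`!%:R * m%:R ^+ j * (m`!%:R / m%:R ^+ m * (a%:R ^+ i / i`!%:R)).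
  have mX : m%:R ^+ m = m%:R ^+ j * m%:R ^+ i :> R by rewrite -exprD subnKC.
  rewrite /bin_coef -/i CE qE expr_div_n mX; field.
  by rewrite !expf_neq0 ?gt_eqF.
have -> : L%:R * (expR (- (p * m%:R)) * (p * m%:R) ^+ j / j`!%:R) =
    p ^+ j / j`!%:R * m%:R ^+ j * (L%:R * (expR 1 ^+ a / expR 1 ^+ m)).
  by rewrite expE exprMn; ring.
apply: ler_wpM2l; first by rewrite !mulr_ge0 ?invr_ge0 ?exprn_ge0.
apply: le_trans (_ : m`!%:R / m%:R ^+ m * (a%:R ^+ a / a`!%:R) <= _).
  by apply: ler_wpM2l mode; rewrite divr_ge0 ?exprn_ge0.
have e0 n : 0 < expR 1 ^+ n :> R by rewrite exprn_gt0 // expR_gt0.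
have H : 0 <= a%:R ^+ a / (a`!%:R * expR 1 ^+ m) :> R.
  by rewrite divr_ge0 ?exprn_ge0 // mulr_ge0 // ltW.
have := ler_wpM2r H S.
have -> : m`!%:R * expR 1 ^+ m / m%:R ^+ m * (a%:R ^+ a / (a`!%:R * expR 1 ^+ m)) =
   m`!%:R / m%:R ^+ m * (a%:R ^+ a / a`!%:R) :> R.
  by field; rewrite !expf_neq0 ?gt_eqF ?expR_gt0.
have -> : L%:R * (a`!%:R * expR 1 ^+ a / a%:R ^+ a) * (a%:R ^+ a / (a`!%:R * expR 1 ^+ m)) =
   L%:R * (expR 1 ^+ a / expR 1 ^+ m) :> R.
  by field; rewrite !expf_neq0 ?gt_eqF ?expR_gt0.
by [].
Qed.

Lemma bin_coefS p q m j :
  bin_coef p q m.+1 j.+1 = q * bin_coef p q m j.+1 + p * bin_coef p q m j.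
Proof.
rewrite /bin_coef binS natrD subSS exprS; case: (ltnP j m) => jm.
  by rewrite -(subnSK jm) exprS; ring.
by rewrite (bin_small (m := j.+1)) //; ring.
Qed.

(* Thinning: a binomial number of successes among a Poisson(t) number of
   trials is Poisson(p t). *)
Lemma is_pois_bin_coef t p j :
  is_pois t (fun m => bin_coef p (1 - p) m j) (expR (- (p * t)) * (p * t) ^+ j / j`!%:R).
Proof.
elim: j => [|j IH].
  rewrite expr0 fact0 divr1 mulr1.
  have := is_pois_geo t (1 - p); rewrite addrAC subrr add0r mulrN mulrC.
  by apply: is_pois_ext => m; rewrite /bin_coef bin0 expr0 !mul1r subn0.
have := is_poisZ (p / j.+1%:R) (is_pois_shift IH).
have -> : p / j.+1%:R * (t * (expR (- (p * t)) * (p * t) ^+ j / j`!%:R)) =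
    expR (- (p * t)) * (p * t) ^+ j.+1 / j.+1`!%:R.
  by rewrite factS natrM exprS; field; rewrite nat1r !pnatr_eq0 -lt0n fact_gt0.
apply: is_pois_ext => m; case: m => [|m].
  by rewrite mul0r mulr0 /bin_coef bin0n !mul0r.
rewrite /bin_coef subSS /= exprS.
have E : m.+1%:R * 'C(m, j)%:R = j.+1%:R * 'C(m.+1, j.+1)%:R :> R.
  by rewrite -!natrM mul_bin_diag.
have -> : p / j.+1%:R * (m.+1%:R * ('C(m, j)%:R * p ^+ j * (1 - p) ^+ (m - j))) =
   p / j.+1%:R * ((m.+1%:R * 'C(m, j)%:R) * (p ^+ j * (1 - p) ^+ (m - j))) by ring.
by rewrite E; field; rewrite nat1r pnatr_eq0.
Qed.
Arguments is_pois_bin_coef : clear implicits.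

(** * Lazy kernels as binomial mixtures *)

Section Lazy.
Variables (M : markovChain R) (L : nat).
Hypotheses (L1 : (1 < L)%N) (lazyM : is_lazy M L%:R^-1).
Local Notation P := (@trans R M).
Implicit Types x y z : M.

Let q : R := L%:R^-1.
Let p : R := 1 - q.
Let L0 : 0 < L%:R :> R. Proof. by rewrite ltr0n ltnW. Qed.
Let q1 : q < 1. Proof. by rewrite invf_lt1 // ltr1n. Qed.
Let p0 : 0 < p. Proof. by rewrite subr_gt0. Qed.

(** The kernel Q in P = q I + p Q, non-negative by laziness. *)
Definition jump x y : R := (P x y - q * (x == y)%:R) / p.

Lemma jump_ge0 x y : 0 <= jump x y.
Proof.
rewrite divr_ge0 ?(ltW p0) // subr_ge0.
by have [<-|_] := eqVneq x y; rewrite ?mulr1 ?mulr0 ?trans_ge0 //; exact: lazyM.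
Qed.

Lemma transE x y : P x y = q * (x == y)%:R + p * jump x y.
Proof. by rewrite /jump; field; rewrite gt_eqF. Qed.

(** The binomial theorem for q I + p Q, by induction with Pascal's rule. *)
Lemma kpow_bin m x y :
  kpow P m x y = \sum_(j < m.+1) bin_coef p q m j * kpow jump j x y.
Proof.
elim: m x => [|m IH] x.
  by rewrite big_ord_recl big_ord0 addr0 /bin_coef bin0 !mul1r.
have -> : kpow P m.+1 x y = q * kpow P m x y + p * \sum_z jump x z * kpow P m z y.
  rewrite /= -[in q * _](sum_eqr x (fun z => kpow P m z y)) !mulr_sumr -big_split /=.
  by apply: eq_bigr => z _; rewrite {1}transE; ring.
have -> : \sum_z jump x z * kpow P m z y =
    \sum_(j < m.+1) bin_coef p q m j * kpow jump j.+1 x y.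
  under eq_bigr do rewrite IH mulr_sumr.
  rewrite exchange_big /=; apply: eq_bigr => j _.
  by rewrite mulr_sumr; apply: eq_bigr => z _; rewrite mulrCA.
have -> : kpow P m x y = \sum_(j < m.+2) bin_coef p q m j * kpow jump j x y.
  rewrite big_ord_recr /= -IH [X in _ + X](_ : _ = 0) ?addr0 //.
  by rewrite /bin_coef bin_small ?mul0r.
rewrite [RHS]big_ord_recl [X in q * X]big_ord_recl mulrDr -addrA; congr (_ + _).
  by rewrite /bin_coef !bin0 !subn0 expr0 exprS; ring.
rewrite !mulr_sumr -big_split /=; apply: eq_bigr => j _.
by rewrite -[bump 0 j]/(j.+1) bin_coefS; ring.
Qed.

(** Both sides mix powers of [jump], so comparing weights suffices. [bin_coef_le] passes to Poisson
    weights of mean p m at the cost of a factor L; moving the mean to p t, with t - m <= L, costs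
    [expR L]. *)
Lemma kpow_le_semigroup a (t : R) x y : (0 < a)%N ->
  (L * a)%:R <= t <= (L * a)%:R + L%:R ->
  kpow P (L * a) x y <= L%:R * expR L%:R * semigroup t x y.
Proof.
move=> a0 /andP[mt tm]; set m := (L * a)%N in mt tm *.
have t0 : 0 <= t by apply: le_trans mt.
have J0 j : 0 <= kpow jump j x y by apply: kpow_ge0; exact: jump_ge0.
have B0 n j : 0 <= bin_coef p q n j.
  by rewrite !mulr_ge0 ?exprn_ge0 ?(ltW p0) // invr_ge0 ltW.
(* By thinning, the semigroup is a Poisson(p t) mixture of powers of [jump]; only the terms j <= m
   are kept. *)
have A : \sum_(j < m.+1) (expR (- (p * t)) * (p * t) ^+ j / j`!%:R) * kpow jump j x y
    <= semigroup t x y.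
  have H := is_pois_sum (fun j : 'I_m.+1 =>
    is_poisZ (kpow jump j x y) (is_pois_bin_coef t p j)).
  under eq_bigr do rewrite mulrC.
  apply: is_pois_le t0 _ H (is_pois_sg t x y) => n.
  rewrite kpow_bin; have -> : 1 - p = q by rewrite /p opprB addrC subrK.
  under eq_bigr do rewrite mulrC.
  rewrite -!(big_mkord xpredT (fun j => bin_coef p q n j * kpow jump j x y)).
  have nn u v : (u <= v)%N ->
      \sum_(0 <= j < u) bin_coef p q n j * kpow jump j x y <=
      \sum_(0 <= j < v) bin_coef p q n j * kpow jump j x y.
    move=> uv; rewrite [leRHS](@big_cat_nat _ _ _ u) //= lerDl.
    by apply: sumr_ge0 => j _; rewrite mulr_ge0.
  case: (leqP m n) => mn; first exact: nn.
  rewrite (@big_cat_nat _ _ _ n.+1) //=; last exact: leqW.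
  rewrite [X in _ + X]big_nat_cond [X in _ + X]big1 ?addr0 // => j /andP[/andP[nj _] _].
  by rewrite /bin_coef bin_small // !mul0r.
have K0 : 0 <= L%:R * expR L%:R :> R by rewrite mulr_ge0 ?expR_ge0.
apply: le_trans _ (ler_wpM2l K0 A).
rewrite kpow_bin mulr_sumr; apply: ler_sum => j _; rewrite mulrA ler_wpM2r //.
apply: le_trans (@bin_coef_le L a j m p L1 a0 erefl erefl) _.
rewrite -[leRHS]mulrA; apply: ler_wpM2l => //.
rewrite !mulrA ler_wpM2r ?invr_ge0 //.
apply: ler_pM; rewrite ?expR_ge0 ?exprn_ge0 ?mulr_ge0 ?(ltW p0) //.
  rewrite -expRD ler_expR.
  have : p * (t - m%:R) <= 1 * L%:R.
    apply: ler_pM; rewrite ?(ltW p0) // ?subr_ge0 //; first by rewrite /p lerBlDr lerDl invr_ge0.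
    by rewrite lerBlDl.
  rewrite mulrBr; lra.
by apply: lerXn2r; rewrite ?nnegrE ?mulr_ge0 ?(ltW p0) // ler_wpM2l // ltW.
Qed.

End Lazy.
End Domination.
Arguments is_pois_bin_coef {R} t p j.

(** * Comparison of mixing times *)

Section MixingTimes.
Variables (R : realType) (M : markovChain R).
Local Notation P := (@trans R M).
Local Notation pi := (@stat R M).
Local Notation k := ((return_dist M)%:R : R).
Implicit Types (x y z : M) (m n : nat).

Let P0 := @trans_ge0 R M.
Let P1 := @trans_sum1 R M.
Let pi0 := @stat_ge0 R M.
Let pi1 := @stat_sum1 R M.

Lemma tv_kpow_le1 n x : tv (kpow P n x) pi <= 1.
Proof.
rewrite /tv ler_pdivrMl ?ltr0n // mulr1.
apply: le_trans (_ : \sum_y (kpow P n x y + pi y) <= _).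
  apply: ler_sum => y _; apply: le_trans (ler_normB _ _) _.
  by rewrite !ger0_norm // kpow_ge0.
by rewrite big_split /= kpow_sum1 // pi1.
Qed.

Lemma tv_kpow_nincr m n x : (m <= n)%N -> tv (kpow P n x) pi <= tv (kpow P m x) pi.
Proof.
move=> /subnKC <-; elim: (n - m)%N => [|d IH]; first by rewrite addn0.
rewrite addnS; apply: le_trans IH; rewrite /tv ler_wpM2l ?invr_ge0 ?ler0n //.
apply: le_trans (_ : \sum_y \sum_z `|kpow P (m + d) x z - pi z| * P z y <= _).
  apply: ler_sum => y _; rewrite kpowSr -(@stat_inv R M y) -sumrB.
  apply: le_trans (ler_norm_sum _ _ _) _; apply: ler_sum => z _.
  by rewrite -mulrBl normrM (ger0_norm (P0 z y)).
rewrite exchange_big /=; apply: ler_sum => z _.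
by rewrite -mulr_sumr P1 mulr1.
Qed.

(** The Poisson variance, from the factorial moment E[N (N - 1)] = t^2. *)
Lemma is_pois_sqr_dev (t : R) : is_pois t (fun n => (n%:R - t) ^+ 2) t.
Proof.
have H1 : is_pois t (fun n => n%:R) t.
  have := is_pois_shift (is_pois_cst t 1); rewrite mulr1.
  by apply: is_pois_ext => n; rewrite mulr1.
have H2 := is_pois_shift H1.
have := is_poisD (is_poisD H2 (is_poisZ (1 - 2 * t) H1)) (is_pois_cst t (t ^+ 2)).
have -> : t * t + (1 - 2 * t) * t + t ^+ 2 = t by ring.
apply: is_pois_ext => -[|n]; first by rewrite !mul0r mulr0; ring.
by rewrite /= -natr1; ring.
Qed.
Arguments is_pois_sqr_dev : clear implicits.

(** The semigroup averages P^N over a Poisson N. For N >= m the distance is at most e, and N < m has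
    probability at most t / (t - m)^2 by Chebyshev. *)
Lemma tv_semigroup_le (t e : R) m x : m%:R < t ->
  tv (kpow P m x) pi <= e -> tv (semigroup t x) pi <= e + t / (t - m%:R) ^+ 2.
Proof.
move=> mt tve; have t0 : 0 <= t by apply: le_trans (ltW mt).
have e0 : 0 <= e := le_trans (tv_ge0 _ _) tve.
have tm : 0 < t - m%:R by rewrite subr_gt0.
pose a y n := `|kpow P n x y - pi y|.
have aB y n : `|a y n| <= 2.
  rewrite normr_id; apply: le_trans (ler_normB _ _) _.
  rewrite !ger0_norm ?kpow_ge0 // -[leRHS]/(1 + 1) lerD ?kpow_le1 //.
  by rewrite -pi1 (bigD1 y) //= lerDl sumr_ge0.
have aP y := is_poisP (t := t) (aB y).
have pa y : `|semigroup t x y - pi y| <= pois t (a y).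
  have D : is_pois t (fun n => kpow P n x y - pi y) (semigroup t x y - pi y).
    rewrite -mulN1r; have := is_poisD (is_pois_sg t x y) (is_poisZ (-1) (is_pois_cst t (pi y))).
    by apply: is_pois_ext => n; rewrite mulN1r.
  have D' : is_pois t (fun n => pi y - kpow P n x y) (pi y - semigroup t x y).
    rewrite -opprB -mulN1r; apply: is_pois_ext (is_poisZ (-1) D) => n.
    by rewrite mulN1r opprB.
  rewrite ler_norml; apply/andP; split.
    rewrite lerNl opprB; apply: is_pois_le t0 _ D' (aP y) => n.
    by rewrite /a distrC ler_norm.
  by apply: is_pois_le t0 _ D (aP y) => n; exact: ler_norm.
rewrite /tv; apply: le_trans (_ : 2^-1 * \sum_y pois t (a y) <= _).
  by rewrite ler_wpM2l ?invr_ge0 ?ler0n // ler_sum.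
have S := is_poisZ 2^-1 (is_pois_sum aP).
have E := is_poisD (is_pois_cst t e) (is_poisZ ((t - m%:R) ^+ 2)^-1 (is_pois_sqr_dev t)).
rewrite [t / _]mulrC; apply: is_pois_le t0 _ S E => n.
rewrite -/(tv (kpow P n x) pi); case: (leqP m n) => mn.
  apply: le_trans (tv_kpow_nincr x mn) _; rewrite -[leLHS]addr0 lerD //.
  by rewrite mulr_ge0 ?sqr_ge0 // invr_ge0 sqr_ge0.
apply: le_trans (tv_kpow_le1 n x) _; rewrite -[leLHS]add0r lerD //.
rewrite ler_pdivlMl ?exprn_gt0 // mulr1 -sqrrN opprB.
rewrite -sqrrN -[leRHS]sqrrN !opprB; apply: lerXn2r; rewrite ?nnegrE ?(ltW tm) //.
  rewrite subr_ge0; apply: le_trans (ltW mt); by rewrite ler_nat ltnW.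
by rewrite lerD2l lerN2 ler_nat ltnW.
Qed.

Lemma tmix_le (t e : R) : 0 <= t -> worst_tv (semigroup (M := M) t) <= e -> tmix M e <= t.
Proof.
move=> t0 H; apply: ge_inf; last by split.
by exists 0 => s [].
Qed.

(** Otherwise t = m + sqrt T / e lies below T, and there the Chebyshev error is at most e, so the
    semigroup would reach level 1 - e before T. *)
Lemma tmix_lower (e : R) m : 0 < e < 2^-1 -> 0 < tmix M (1 - e) ->
  worst_tv (kpow P m) <= 1 - 2 * e ->
  tmix M (1 - e) - 2 / e * Num.sqrt (tmix M (1 - e)) <= m%:R.
Proof.
set T := tmix M (1 - e) => /andP[e0 e1] T0 wm; rewrite leNgt; apply/negP => mT.
have s0 : 0 < Num.sqrt T by rewrite sqrtr_gt0.
have sE : Num.sqrt T ^+ 2 = T by rewrite sqr_sqrtr // ltW.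
pose u := Num.sqrt T / e; have u0 : 0 < u by rewrite divr_gt0.
pose t := m%:R + u.
have tT : t < T by move: mT u0; rewrite /t /u; lra.
have t0 : 0 < t by rewrite /t ltr_wpDl.
have : T <= t; last by rewrite leNgt tT.
apply: tmix_le; first exact: ltW.
have e1' : 0 <= 1 - e by lra.
have e2' : 0 <= 1 - 2 * e by lra.
apply/(worst_tv_leP _ e1') => x.
have := (worst_tv_leP _ e2').2 wm x => /(tv_semigroup_le (t := t)).
have mt : m%:R < t by rewrite /t ltrDl.
move=> /(_ mt) H; apply: le_trans H _.
have -> : t - m%:R = u by rewrite /t addrC addKr.
have : t / u ^+ 2 <= e; last by lra.
rewrite ler_pdivrMr ?exprn_gt0 //; apply: le_trans (ltW tT) _.
have -> : e * u ^+ 2 = T / e by rewrite /u -[in RHS]sE; field; rewrite gt_eqF.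
by rewrite ler_pdivlMr // ler_piMr ?ltW //; lra.
Qed.

(** The numerator in the hypothesis of the theorem; the mixing times differ from T by at most a
    constant times this times sqrt T. *)
Definition cutoff_window : R := k ^+ 2 * (1 + ln (Delta M)) * trel M.

Lemma trel_le_window : trel M <= cutoff_window.
Proof.
have k1 := return_dist_ge1 M; have l0 := ln_ge0 (Delta_ge1 M).
rewrite /cutoff_window ler_peMl //.
  by apply: le_trans (trel_ge M); rewrite invr_ge0.
by rewrite mulr_ege1 ?exprn_ege1 // lerDl.
Qed.

End MixingTimes.
Arguments is_pois_sqr_dev {R} t.

(** * Upper bound for the discrete mixing time *)

Section Upper.
Variables (R : realType) (delta e : R).
Hypotheses (d01 : 0 < delta < 1) (e01 : 0 < e < 2^-1).

(** An integer L is wanted because the binomial comparison is made at multiples of L. *)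
Lemma ex_lazy_order : exists L : nat, (1 < L)%N /\ L%:R^-1 <= delta.
Proof.
have /andP[d0 d1] := d01; exists (Num.truncn delta^-1).+1.
have dV : 1 <= delta^-1 by rewrite invf_ge1 // ltW.
have /andP[a b] := truncn_itv (le_trans ler01 dV).
split; last by rewrite invf_ple ?posrE ?ltr0n // ltW.
by rewrite ltnS truncn_gt0.
Qed.

(** C and T0 depend on delta and e only. After L a steps, a = floor(t / L), the density is at most B
    off a set of mass at most e; r further steps contract the bounded part to within e. *)
Lemma tmix_upper : exists C T0 : R, [/\ 0 <= C, 1 <= T0 &
  forall M : markovChain R, is_lazy M delta -> (0 <= BE_curvature M)%E ->
  T0 <= tmix M (1 - e) -> cutoff_window M <= Num.sqrt (tmix M (1 - e)) ->
  exists m, worst_tv (kpow (@trans R M) m) <= 2 * e /\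
    m%:R <= tmix M (1 - e) + C * (cutoff_window M * Num.sqrt (tmix M (1 - e)))].
Proof.
have [L [L1 Ld]] := ex_lazy_order.
have /andP[d0 d1] := d01; have /andP[e0 e1] := e01.
have L1R : 1 < L%:R :> R by rewrite ltr1n.
have L0R : 0 < L%:R :> R by exact: lt_trans L1R.
pose Kc : R := L%:R * expR L%:R.
have Kc1 : 1 <= Kc by rewrite mulr_ege1 ?(ltW L1R) // ltW // expR_gt1.
have Kc0 : 0 < Kc by exact: lt_le_trans Kc1.
(* The domination factor Kc turns the exceptional mass eta into e. *)
pose eta := e / Kc.
have eta01 : 0 < eta <= 1.
  by rewrite divr_gt0 //= ler_pdivrMr // mul1r; apply: le_trans Kc1; lra.
have /andP[eta0 eta1] := eta01.
pose c1 : R := (expR 1 + 8 + 32 / e) * (2 / e + 1 / eta).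
pose c2 : R := ln Kc + ln (2 / e) + ln e^-1.
have c10 : 0 <= c1.
  rewrite mulr_ge0 ?addr_ge0 ?expR_ge0 ?divr_ge0 // ltW //.
have c20 : 0 <= c2.
  by rewrite !addr_ge0 // ln_ge0 //; rewrite ?invf_ge1 // ?ler_pdivlMr //; lra.
pose c3 : R := 2 / delta * (c1 + c2).
have c30 : 0 <= c3 := mulr_ge0 (divr_ge0 (ler0n R 2) (ltW d0)) (addr_ge0 c10 c20).
(* Taking T0 = L ensures a >= 1. *)
exists (2 * c3 + 4), L%:R; split; rewrite ?(ltW L1R) //.
  exact: addr_ge0 (mulr_ge0 (ler0n R 2) c30) (ler0n R 4).
move=> M lazyM BE; set T := tmix M (1 - e); set W := cutoff_window M => LT WT.
have T1 : 1 <= T := le_trans (ltW L1R) LT.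
have T0 : 0 < T by exact: lt_le_trans T1.
have sT1 : 1 <= Num.sqrt T by rewrite -(sqrtr1 R) ler_wsqrtr.
have sT0 : 0 < Num.sqrt T by exact: lt_le_trans sT1.
have sTE : Num.sqrt T ^+ 2 = T by rewrite sqr_sqrtr // ltW.
have sTT : Num.sqrt T <= T by rewrite -[leRHS]sTE expr2 ler_peMl // ltW.
(* The defining set of T is not empty, since the infimum would then be 0. *)
have [t [[t0 wt] [Tt tT]]] : exists t : R,
    (0 <= t /\ worst_tv (semigroup (M := M) t) <= 1 - e) /\ (T <= t /\ t < T + 1).
  set S := [set t : R | 0 <= t /\ worst_tv (semigroup (M := M) t) <= 1 - e].
  have S0 : S !=set0.
    by apply/set0P/eqP => S0; move: T0; rewrite /T /tmix -/S S0 inf0 ltxx.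
  have iS : has_inf S by split => //; exists 0 => s [].
  have [t St tlt] := inf_adherent ltr01 iS.
  exists t; split => //; split => //; apply: ge_inf => //; by exists 0 => s [].
have t1 : 1 <= t := le_trans T1 Tt.
have st2 : Num.sqrt t <= 2 * Num.sqrt T.
  rewrite -[leRHS]ger0_norm ?mulr_ge0 ?sqrtr_ge0 // -sqrtr_sqr ler_wsqrtr //.
  by rewrite exprMn sTE; lra.
have st1 : 1 <= Num.sqrt t by rewrite -(sqrtr1 R) ler_wsqrtr.
have trt : trel M <= t.
  apply: le_trans (trel_le_window M) _; apply: le_trans WT _.
  exact: le_trans sTT Tt.
have tr0 : 0 < trel M by apply: lt_le_trans (trel_ge M); rewrite invr_gt0.
have e01' : 0 < e < 1 by rewrite e0 /=; lra.
have e1' : 0 <= 1 - e by lra.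
have tvt := (worst_tv_leP (semigroup t) e1').2 wt.
have Kcurv := BE_curvature_ge0 BE.
pose a := Num.truncn (t / L%:R).
have tL : 1 <= t / L%:R by rewrite ler_pdivlMr // mul1r (le_trans LT).
have /andP[ta1 ta2] := truncn_itv (le_trans ler01 tL).
have a0 : (0 < a)%N by rewrite truncn_gt0.
have aT : (L * a)%:R <= t <= (L * a)%:R + L%:R.
  rewrite natrM; apply/andP; split; first by rewrite mulrC -ler_pdivlMr.
  by move: ta2; rewrite -natr1 ltr_pdivrMr // mulrDl mul1r mulrC => /ltW.
have lazyL : is_lazy M L%:R^-1 by move=> x; apply: le_trans Ld (lazyM x).
have [/andP[aT1 aT2]] := aT.
pose al := log_lip M e * Num.sqrt t * (2 / e + 1 / eta) + ln (2 / e).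
pose B := Kc * expR al.
(* Solves exp(- rr delta / trel) B^2 = e^2; the integer r exceeds it by at most 1. *)
pose rr := trel M / delta * (2 * (ln Kc + al + ln e^-1)).
have l1 : 1 <= 1 + ln (Delta M) by rewrite lerDl ln_ge0 // Delta_ge1.
have k1 := return_dist_ge1 M.
set kl := (return_dist M)%:R ^+ 2 * (1 + ln (Delta M)) : R.
have kl1 : 1 <= kl by rewrite mulr_ege1 // exprn_ege1.
have kls1 : 1 <= kl * Num.sqrt t by rewrite mulr_ege1.
have rrle : rr <= c3 * (W * Num.sqrt t).
  have -> : c3 * (W * Num.sqrt t) =
      trel M / delta * (2 * (c1 * (kl * Num.sqrt t) + c2 * (kl * Num.sqrt t))).
    by rewrite /c3 /W /cutoff_window -/kl; ring.
  rewrite ler_wpM2l ?divr_ge0 ?(ltW tr0) ?(ltW d0) // ler_wpM2l //.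
  have -> : ln Kc + al + ln e^-1 = c1 * (kl * Num.sqrt t) + c2.
    by rewrite /al /c1 /c2 /log_lip -/kl; ring.
  by rewrite lerD2l ler_peMr.
have al0 : 0 <= al.
  rewrite /al; have -> : log_lip M e * Num.sqrt t * (2 / e + 1 / eta) = c1 * (kl * Num.sqrt t).
    by rewrite /c1 /log_lip -/kl; ring.
  apply: addr_ge0; first by apply: mulr_ge0 => //; exact: le_trans kls1.
  by rewrite ln_ge0 // ler_pdivlMr //; lra.
have rr0 : 0 <= rr.
  apply: mulr_ge0; first by rewrite divr_ge0 // ltW.
  apply: mulr_ge0 => //; apply: addr_ge0; first by rewrite addr_ge0 // ln_ge0.
  by rewrite ln_ge0 // invf_ge1 //; lra.
pose r := (Num.truncn rr).+1.
have /andP[r1 r2] := truncn_itv rr0.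
exists (L * a + r)%N; split.
  have e2 : 0 <= 2 * e by rewrite mulr_ge0 // ltW.
  apply/(worst_tv_leP _ e2) => x.
  have -> : kpow (@trans R M) (L * a + r) x =
      push (kpow (@trans R M) r) (kpow (@trans R M) (L * a) x).
    by apply/funext => y; rewrite kpowD.
  have -> : 2 * e = (2 * e) / 2 + e by field.
  pose A y := semigroup t x y <= expR al * stat y.
  have dom y : kpow (@trans R M) (L * a) x y <= Kc * semigroup t x y.
    exact: kpow_le_semigroup.
  apply: (@tv_push_le R M delta d01 lazyM _ A B).
  - by move=> y; apply: kpow_ge0; exact: trans_ge0.
  - by apply: kpow_sum1; exact: trans_sum1.
  - move=> y Ay; apply: le_trans (dom y) _.
    by rewrite /B -mulrA ler_wpM2l // ltW.
  - apply: le_trans (_ : Kc * \sum_(y | ~~ A y) semigroup t x y <= _).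
      by rewrite mulr_sumr; apply: ler_sum => y _.
    have -> : e = Kc * eta by rewrite /eta mulrC divfK // gt_eqF.
    rewrite ler_wpM2l ?(ltW Kc0) //.
    apply: le_trans (density_concentration t1 trt e01' tvt Kcurv x eta01).
    by under eq_bigl => y do rewrite /A -ltNge.
  - by rewrite mulr_ge0 ?expR_ge0 // ltW.
  - by rewrite mulr_gt0.
  - have BE2 : B = expR (ln Kc + al) by rewrite expRD lnK.
    have rD : 2 * (ln Kc + al + ln e^-1) <= r%:R * delta / trel M.
      rewrite ler_pdivlMr // -ler_pdivrMr //.
      by rewrite [leLHS](_ : _ = rr) ?(ltW r2) // /rr; ring.
    rewrite BE2 -expRM_natl -expRD.
    apply: le_trans (_ : expR (2 * ln e) <= _).
      by rewrite ler_expR; move: rD; rewrite lnV ?posrE //; lra.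
    rewrite expRM_natl lnK ?posrE //; apply: lerXn2r; rewrite ?nnegrE //; lra.
rewrite natrD; have -> : r%:R = (Num.truncn rr)%:R + 1 :> R by rewrite natr1.
have W1 : 2^-1 <= W by apply: le_trans (trel_ge M) (trel_le_window M).
have W0 : 0 <= W by apply: le_trans W1; rewrite invr_ge0.
have WT1 : 2^-1 * 1 <= W * Num.sqrt T by apply: ler_pM.
have Wst : W * Num.sqrt t <= W * (2 * Num.sqrt T) by rewrite ler_wpM2l.
have : c3 * (W * Num.sqrt t) <= c3 * (W * (2 * Num.sqrt T)) by rewrite ler_wpM2l.
have -> : (2 * c3 + 4) * (W * Num.sqrt T) =
  c3 * (W * (2 * Num.sqrt T)) + 4 * (W * Num.sqrt T) by ring.
lra.
Qed.

End Upper.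

(** * Cutoff *)

Section Asymptotics.
Variable R : realType.

Lemma cutoff_window_ge (M : markovChain R) : 2^-1 <= cutoff_window M.
Proof. exact: le_trans (trel_ge M) (trel_le_window M). Qed.

(** For T <= 0 the square root is 0 and the quotient +oo, so a finite bound forces T > 0. *)
Lemma window_quotient_lt (W T eta : R) : 0 < W ->
  (W%:E / (Num.sqrt T)%:E < eta%:E)%E -> 0 < T /\ W < eta * Num.sqrt T.
Proof.
move=> W0; rewrite inver; case: ifPn => [_|s0].
  by rewrite gt0_muley ?lte_fin // ltNge leey.
rewrite -EFinM lte_fin => H.
have s1 : 0 < Num.sqrt T by rewrite lt0r s0 sqrtr_ge0.
by split; [rewrite -sqrtr_gt0 | rewrite -ltr_pdivrMr].
Qed.

(** One reference time serves all levels a: [tmix_upper] reaches 2 e <= a, and [tmix_lower] applies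
    since a <= 1 - 2 e. *)
Lemma tmix_d_close (delta e : R) : 0 < delta < 1 -> 0 < e < 2^-1 ->
  exists C T0 : R, [/\ 0 < C, 1 <= T0 &
  forall M : markovChain R, is_lazy M delta -> (0 <= BE_curvature M)%E ->
  T0 <= tmix M (1 - e) -> cutoff_window M <= Num.sqrt (tmix M (1 - e)) ->
  forall a, 2 * e <= a <= 1 - 2 * e ->
  `|tmix_d M a - tmix M (1 - e)| <=
     C * (cutoff_window M * Num.sqrt (tmix M (1 - e)))].
Proof.
move=> d01 e01; have [C [T0 [C0 T01 H]]] := tmix_upper d01 e01.
have /andP[e0 e1] := e01.
exists (C + 4 / e), T0; split => //; first by rewrite ltr_wpDl // divr_gt0.
move=> M lazyM BE TT WT a /andP[ae ea].
set T := tmix M (1 - e) in TT WT *; set W := cutoff_window M in WT *.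
have T1 : 1 <= T := le_trans T01 TT.
have T00 : 0 < T by exact: lt_le_trans T1.
have W1 : 2^-1 <= W := cutoff_window_ge M.
have s0 : 0 <= Num.sqrt T := sqrtr_ge0 T.
have sW : 2^-1 * Num.sqrt T <= W * Num.sqrt T by rewrite ler_wpM2r.
have [m [wm mT]] := H M lazyM BE TT WT.
rewrite -/T -/W in mT.
set S := [set (m%:R : R) | m in [set m : nat | worst_tv (kpow (@trans R M) m) <= a]].
have Sm : S m%:R by exists m => //=; exact: le_trans wm ae.
have lowS : lbound S (T - 2 / e * Num.sqrt T).
  move=> _ [n /= wn <-]; apply: tmix_lower => //; exact: le_trans wn ea.
have up : tmix_d M a <= m%:R by apply: ge_inf => //; exists (T - 2 / e * Num.sqrt T).
have low : T - 2 / e * Num.sqrt T <= tmix_d M a by apply: lb_le_inf => //; exists m%:R.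
have e4 : 0 < 4 / e by rewrite divr_gt0.
(* Since W >= 1/2, the term (2 / e) sqrt T of the lower bound is absorbed. *)
have sWe : 4 / e * (2^-1 * Num.sqrt T) <= 4 / e * (W * Num.sqrt T).
  by rewrite ler_wpM2l // ltW.
have sW0 : 0 <= W * Num.sqrt T by rewrite mulr_ge0 // (le_trans _ W1) // invr_ge0.
have CW : 0 <= C * (W * Num.sqrt T) by rewrite mulr_ge0.
have eW : 0 <= 4 / e * (W * Num.sqrt T) by rewrite mulr_ge0 // ltW.
have E2 : 4 / e * (2^-1 * Num.sqrt T) = 2 / e * Num.sqrt T by field; rewrite gt_eqF.
rewrite E2 in sWe.
rewrite ler_norml mulrDl; apply/andP; split; lra.
Qed.

End Asymptotics.

(* Quotients are taken in \bar R, where a / 0 = +oo for a > 0. *)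
Theorem theorem1p3 (R : realType) (delta : R) (M : nat -> markovChain R)
  (hdelta : 0 < delta < 1)
  (hlazy : forall n, is_lazy (M n) delta)
  (hBE : forall n, (0 <= BE_curvature (M n))%E)
  (hlim : forall e : R, 0 < e < 2^-1 ->
    (((return_dist (M n))%:R ^+ 2 * (1 + ln (Delta (M n))) * trel (M n))%:E
       / (Num.sqrt (tmix (M n) (1 - e)))%:E)%E @[n --> \oo] --> 0%:E) :
  forall e : R, 0 < e < 1 ->
    ((tmix_d (M n) e)%:E / (tmix_d (M n) (1 - e))%:E)%E @[n --> \oo] --> 1%:E.
Proof.
move=> e /andP[e0 e1].
(* Both e and 1 - e lie in [2 q, 1 - 2 q]. *)
pose q := Num.min e (1 - e) / 3.
have m0 : 0 < Num.min e (1 - e) by rewrite lt_min e0 subr_gt0.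
have me : Num.min e (1 - e) <= e by rewrite ge_min lexx.
have me' : Num.min e (1 - e) <= 1 - e by rewrite ge_min lexx orbT.
have q01 : 0 < q < 2^-1 by rewrite /q; apply/andP; split; lra.
have [C [T0 [C0 T01 H]]] := tmix_d_close hdelta q01.
have T00 : 0 < T0 by exact: lt_le_trans T01.
pose T n := tmix (M n) (1 - q).
have near_close (z : R) : 0 < z -> \forall n \near \oo, [/\ 0 < T n,
    `|tmix_d (M n) e - T n| <= z * T n & `|tmix_d (M n) (1 - e) - T n| <= z * T n].
  (* The three bounds on eta give C W sqrt T <= z T, W <= sqrt T and, as W >= 1/2, sqrt T >= T0. *)
  move=> z0; pose eta := Num.min (z / C) (Num.min 1 (2 * T0)^-1).
  have eta0 : 0 < eta by rewrite !lt_min ltr01 divr_gt0 //= invr_gt0 mulr_gt0.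
  have nb : nbhs (0%:E : \bar R) [set x : \bar R | (x < eta%:E)%E].
    exact: (nbhs_open_ereal_lt (r := 0) (f := fun=> eta)).
  have : \forall n \near \oo, ((cutoff_window (M n))%:E / (Num.sqrt (T n))%:E < eta%:E)%E.
    exact: (hlim q q01 _ nb).
  apply: filterS => n Hn.
  have W1 := cutoff_window_ge (M n).
  have W0 : 0 < cutoff_window (M n) by apply: lt_le_trans W1; rewrite invr_gt0.
  have [Tn WT] := window_quotient_lt W0 Hn.
  set s := Num.sqrt (T n) in WT.
  have s0 : 0 < s by rewrite sqrtr_gt0.
  have sE : s ^+ 2 = T n by rewrite sqr_sqrtr // ltW.
  have ez : eta <= z / C by rewrite ge_min lexx.
  have et1 : eta <= 1 by rewrite ge_min ge_min lexx orbT.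
  have et2 : eta <= (2 * T0)^-1 by rewrite !ge_min lexx !orbT.
  have sT : T0 <= s.
    have : eta * s <= (2 * T0)^-1 * s by rewrite ler_wpM2r // ltW.
    rewrite invfM -mulrA => A; have : 2^-1 * 1 <= 2^-1 * (T0^-1 * s) by lra.
    by rewrite ler_pM2l ?invr_gt0 // ler_pdivlMl // mulr1.
  have sTn : s <= T n by rewrite -sE expr2 ler_peMl ?(ltW s0) // (le_trans T01).
  have Ws : cutoff_window (M n) <= s.
    by apply: le_trans (ltW WT) _; rewrite ler_piMl // ltW.
  have bnd : C * (cutoff_window (M n) * s) <= z * T n.
    apply: le_trans (_ : C * (z / C * T n) <= _); last first.
      by rewrite mulrA (mulrC C) divfK ?gt_eqF.
    rewrite ler_wpM2l ?(ltW C0) // -sE expr2 mulrA ler_wpM2r ?(ltW s0) //.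
    by apply: le_trans (ltW WT) _; rewrite ler_wpM2r // ltW.
  have close := H (M n) (hlazy n) (hBE n) (le_trans sT sTn) Ws.
  split=> //; apply: le_trans bnd; apply: close; rewrite /q; lra.
have cv : (fun n => tmix_d (M n) e / tmix_d (M n) (1 - e)) @ \oo --> (1 : R).
  apply/cvgrPdist_le => eps eps0.
  (* Then v >= T / 2 and |u - v| <= 2 z T <= eps T / 2 <= eps v. *)
  pose z := Num.min (2^-1) (eps / 4).
  have z0 : 0 < z by rewrite lt_min invr_gt0 ltr0n divr_gt0.
  have z1 : z <= 2^-1 by rewrite ge_min lexx.
  have z2 : z <= eps / 4 by rewrite ge_min lexx orbT.
  move: (near_close z z0); apply: filterS => n [Tn A1 A2].
  set u := tmix_d _ e in A1 *; set v := tmix_d _ (1 - e) in A2 *.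
  have zT1 : z * T n <= 2^-1 * T n by rewrite ler_wpM2r // ltW.
  have zT2 : z * T n <= eps / 4 * T n by rewrite ler_wpM2r // ltW.
  move: A1 A2; rewrite !ler_norml => /andP[a1 a2] /andP[b1 b2].
  have v0 : 0 < v by lra.
  have -> : 1 - u / v = (v - u) / v by field; rewrite gt_eqF.
  rewrite ler_pdivlMr // ler_pdivrMr //.
  have : eps * (2^-1 * T n) <= eps * v by rewrite ler_wpM2l ?(ltW eps0) //; lra.
  by move=> ?; apply/andP; split; lra.
have cvE : (fun n => (tmix_d (M n) e / tmix_d (M n) (1 - e))%:E) @ \oo --> 1%:E.
  by apply: cvg_EFin cv; exact: nearW.
apply: cvg_trans cvE; apply: near_eq_cvg.
(* With z = 1/2 the denominator is eventually positive, so the extended quotient is the real one. *)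
have z0 : 0 < 2^-1 :> R by rewrite invr_gt0.
move: (near_close _ z0); apply: filterS => n [Tn _].
rewrite ler_norml => /andP[b1 b2].
by rewrite inver ifF // gt_eqF //; lra.
Qed.
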